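(* Let $p,q\ge1$ be integers. Suppose that $X_1=(X_{1,1},\dots,X_{p,1})'$ and $X_2=(X_{1,2},\dots,X_{q,2})'$ are random vectors such that $(X_1,X_2)$ is jointly Gaussian and centered, and no nontrivial linear combination of components of $X_1$ is (almost surely) equal to any nontrivial linear combination of components of $X_2$. Suppose measurable functions $G_1:\mathbb{R}^p\to\mathbb{R}$ and $G_2:\mathbb{R}^q\to\mathbb{R}$ are such that $G_1(X_1)$ and $G_2(X_2)$ have the same distribution, which is continuous at its upper end point. Then $G_1(X_1)$ and $G_2(X_2)$ are extremally independent.
   Context: A nontrivial linear combination is one whose coefficients are not all zero. For a distribution function $F$, the upper end point is $U_F=\sup\{x\in\mathbb{R}:F(x)<1\}$; the distribution is continuous at its upper end point if $\lim_{x\uparrow U_F}F(x)=1$. Two random variables $Y_1,Y_2$ with the same distribution function $F$, continuous at its upper end point, are extremally independent if $\lim_{x\uparrow U_F}\mathbb{P}(Y_1>x,Y_2>x)/(1-F(x))=0$. *)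

(* Defs.v *)
From HB Require Import structures.
From mathcomp Require Import all_boot all_order all_algebra.
From mathcomp Require Import all_classical all_reals all_analysis.
Set Implicit Arguments.
Unset Strict Implicit.
Unset Printing Implicit Defensive.
Import Order.TTheory GRing.Theory Num.Theory.
Import numFieldNormedType.Exports.
Local Open Scope classical_set_scope.
Local Open Scope ring_scope.

(* R^n is [n.-tuple R], whose sigma-algebra is generated by the coordinates
   (i.e. the Borel one), so a random vector is an [{RV P >-> n.-tuple R}]. *)

(* N(m, s^2), including the degenerate case: [normal_prob m 0] is the uniform
   law on [0, 1] in the library, not the Dirac mass at m. *)
Definition gaussian_law (R : realType) (m s : R) (A : set R) : \bar R :=
  if s == 0 then \d_m A else normal_prob m s A.

Definition lincomb (R : realType) (n : nat) (a : 'rV[R]_n) (v : n.-tuple R)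
  : R := \sum_(i < n) a 0 i * tnth v i.

Section gaussian.
Context (d : measure_display) (T : measurableType d) (R : realType).
Variable P : probability T R.

(* Laws are compared on measurable sets only: on other sets both sides carry
   meaningless values. *)
Definition is_gaussian (Z : T -> R) : Prop :=
  exists m s : R, forall A : set R, measurable A ->
    pushforward P Z A = gaussian_law m s A.

Definition gaussian_vector (n : nat) (X : T -> n.-tuple R) : Prop :=
  forall a : 'rV[R]_n, is_gaussian (fun t => lincomb a (X t)).

Definition centered (n : nat) (X : T -> n.-tuple R) : Prop :=
  forall i : 'I_n, ('E_P[fun t => tnth (X t) i] = 0)%E.

Definition same_distribution (Y1 Y2 : {RV P >-> R}) : Prop :=
  forall A : set R, measurable A -> distribution P Y1 A = distribution P Y2 A.

End gaussian.

Section extremal_independence.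
Context (d : measure_display) (T : measurableType d) (R : realType).
Context (P : probability T R).
Implicit Types Y : {RV P >-> R}.

Definition upper_endpoint Y : \bar R :=
  ereal_sup [set x%:E | x in [set x : R | (cdf Y x < 1)%E]].

(* The filter of x : R increasing to u. The case -oo does not occur for the
   upper end point of a distribution function. *)
Definition increasing_to (u : \bar R) : set_system R :=
  match u with
  | r%:E => r^'-
  | +oo%E => pinfty_nbhs R
  | -oo%E => ninfty_nbhs R
  end.

Definition continuous_at_upper_endpoint Y : Prop :=
  cdf Y x @[x --> increasing_to (upper_endpoint Y)] --> 1%E.

Definition extremally_independent (Y1 Y2 : {RV P >-> R}) : Prop :=
  [/\ cdf Y1 =1 cdf Y2,
      continuous_at_upper_endpoint Y1
    & fine (P [set t | x < Y1 t /\ x < Y2 t]) / (1 - fine (cdf Y1 x))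
        @[x --> increasing_to (upper_endpoint Y1)] --> (0 : R)].

End extremal_independence.

(* Main.v *)
Require Import Defs.
From HB Require Import structures.
From mathcomp Require Import all_boot all_order all_algebra.
From mathcomp Require Import all_classical all_reals all_analysis.
From mathcomp Require Import measurable_realfun.
From mathcomp Require Import ring lra.
Set Implicit Arguments.
Unset Strict Implicit.
Unset Printing Implicit Defensive.
Import Order.TTheory GRing.Theory Num.Theory.
Import numFieldNormedType.Exports.
Local Open Scope classical_set_scope.
Local Open Scope ring_scope.

(* Let [Sigma] be the covariance of [(X1, X2)] and [D] its block diagonal
   part. The hypothesis on linear combinations says that the null space of
   [Sigma] is contained in that of [D], so that [Sigma >= s^2 D] for some
   [0 < s < 1]. Hence [(X1, X2)] has the law of [(s B1 U1 + M1 U, s B2 U2 + M2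
   U)], where [U1], [U2], [U] are independent standard Gaussian vectors, and
   [M1 U] has the law of [r B1 V] with [s^2 + r^2 = 1] and [V] standard
   Gaussian (laws are identified through those of linear combinations, as in
   Cramer-Wold). Conditioning on [U], [P(X1 in A, X2 in B) = E f(U) g(U) <=
   (E f(U)^2 + E g(U)^2) / 2], and [E f(U)^2 = E F(r V)^2] with [F y = P(B1
   (s U1 + y) in A)], while [E F(r V) = P(X1 in A) =: e]. The Cameron-Martin
   formula gives the Harnack inequality [F x ^ 2 <= F y * exp (|x - y|^2 /
   s^2)], which integrated in [y] yields [F (r V) ^ 2 <= e * psi V] with
   [psi V] integrable. Bounding [F (r V)] by [sqrt (e K)] where [psi V <=
   K], and by the previous inequality elsewhere, shows that [E F(r V)^2 =
   o(e)] when [e] tends to [0]. *)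

(** * Positive semidefinite matrices *)

(** The covariance may be singular and the blocks may be correlated, so there is in general no joint
    density to compare with a product. The order [Sigma >= s^2 D] replaces it: each block keeps an
    independent share of noise, shaped like its own law. This noise enters in isotropic form before
    [B1] or [B2] is applied, so a singular [B1] does not spoil the Harnack constant. Only an
    inclusion of null spaces is available, not invertibility, because one of the vectors may have
    linearly dependent components.

    Integrating [F (r V) ^ 2 <= e * psi V] as it stands gives only [O(e)]. The gain comes from [psi]
    being the same for all events: the level [K] is chosen from the tail of [psi] alone, and [e]
    tends to [0] afterwards. Up to a constant, [psi v] is [exp (th |v|^2)] with
    [th = r^2 / (1 + r^2)]; since [s > 0] forces [r < 1], the exponent satisfies [th < 1/2], which
    is what integrability against the Gaussian law requires. The half sum of the two second moments
    is enough because both events have the same probability [e]. *)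

Definition sqn (R : realType) n (a : 'rV[R]_n) : R := \sum_i a 0 i ^+ 2.

Lemma sqn_ge0 (R : realType) n (a : 'rV[R]_n) : 0 <= sqn a.
Proof. by apply: sumr_ge0 => i _; exact: sqr_ge0. Qed.

Lemma sqnE (R : realType) n (a : 'rV[R]_n) : (a *m a^T) 0 0 = sqn a.
Proof. by rewrite mxE; apply: eq_bigr => i _; rewrite mxE expr2. Qed.

Lemma sqn_eq0 (R : realType) n (a : 'rV[R]_n) : sqn a = 0 -> a = 0.
Proof.
move=> /eqP; rewrite psumr_eq0; last by move=> i _; exact: sqr_ge0.
move=> /allP h; apply/rowP => i; rewrite mxE.
by apply/eqP; rewrite -sqrf_eq0; apply: h; rewrite mem_index_enum.
Qed.

Lemma sqnZ (R : realType) n k (a : 'rV[R]_n) : sqn (k *: a) = k ^+ 2 * sqn a.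
Proof. by rewrite mulr_sumr; apply: eq_bigr => i _; rewrite mxE exprMn. Qed.

Lemma sqn_mulmx_le (R : realType) k l (E : 'M[R]_(k, l)) :
  exists2 C : R, 0 < C & forall b : 'rV[R]_k, sqn (b *m E) <= C * sqn b.
Proof.
(* Each [|b_i|] is at most the square root of [sqn b], so the entry [j] of [b *m E] is at most that
   root times the absolute sum of column [j]. The summand [1] makes the constant positive. *)
exists (1 + \sum_j (\sum_i `|E i j|) ^+ 2).
  by rewrite ltr_pwDl// sumr_ge0// => j _; exact: sqr_ge0.
move=> b; rewrite mulrDl mul1r mulr_suml.
apply: ler_wpDl; first exact: sqn_ge0.
apply: ler_sum => j _.
rewrite -[X in _ <= _ * X](sqr_sqrtr (sqn_ge0 b)) -exprMn.
rewrite -real_normK ?num_real// ler_sqr ?nnegrE//; last first.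
  by rewrite mulr_ge0 ?sqrtr_ge0// sumr_ge0.
rewrite mxE mulr_suml (le_trans (ler_norm_sum _ _ _))//.
apply: ler_sum => i _; rewrite normrM mulrC ler_wpM2l//.
rewrite -sqrtr_sqr ler_wsqrtr// /sqn (bigD1 i)//= lerDl.
by apply: sumr_ge0 => ? _; exact: sqr_ge0.
Qed.

(** The inclusion of kernels makes [L] factor as [M *m D^T], and multiplication by a fixed matrix is
    bounded; no eigenvalue or compactness argument is involved. *)
Lemma sqn_ker_le (R : realType) n k l (M : 'M[R]_(n, k)) (L : 'M[R]_(n, l)) :
  (forall a : 'rV[R]_n, a *m M = 0 -> a *m L = 0) ->
  exists2 C : R, 0 < C & forall a : 'rV[R]_n, sqn (a *m L) <= C * sqn (a *m M).
Proof.
move=> kerML.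
have LM : (L^T <= M^T)%MS.
  rewrite submxE; apply/eqP/trmx_inj; rewrite trmx_mul trmxK trmx0.
  apply/row_matrixP => i; rewrite row_mul row0; apply: kerML.
  by rewrite -row_mul -[X in _ *m X]trmxK -trmx_mul mulmx_coker trmx0 row0.
have /submxP[D LE] := LM.
have [C C0 hC] := sqn_mulmx_le D^T.
exists C => // a; have -> : L = M *m D^T by rewrite -[L]trmxK LE trmx_mul trmxK.
by rewrite mulmxA.
Qed.

(** Cholesky factorisation by induction on the size, through the Schur complement of the corner
    entry [s]. A zero pivot is allowed: positivity then forces the rest of its row to vanish. *)
Lemma psd_factor (R : realType) n (S : 'M[R]_n) : S^T = S ->
  (forall a : 'rV[R]_n, 0 <= (a *m S *m a^T) 0 0) ->
  exists M : 'M[R]_n, S = M *m M^T.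
Proof.
elim: n S => [|n IH] S; first by exists 0; apply/matrixP => -[].
rewrite -[n.+1]/(1 + n)%N in S * => symS psdS.
pose s := S 0 0; pose v := ursubmx S; pose S1 := drsubmx S.
have sE : ulsubmx S = s%:M by rewrite [LHS]mx11_scalar !mxE !lshift0.
have SE : S = block_mx s%:M v v^T S1.
  by rewrite -[LHS]submxK sE /v trmx_ursub symS.
have symS1 : S1^T = S1 by rewrite /S1 trmx_drsub symS.
have Q t (b : 'rV[R]_n) : 0 <= s * t ^+ 2 + 2 * t * (v *m b^T) 0 0
     + (b *m S1 *m b^T) 0 0.
  have := psdS (row_mx t%:M b); rewrite SE mul_row_block tr_row_mx mul_row_col.
  rewrite !mulmxDl tr_scalar_mx -!scalar_mxM !mul_scalar_mx !mul_mx_scalar.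
  have -> : b *m v^T = v *m b^T.
    by rewrite [LHS]mx11_scalar -[in LHS]mx11_scalar -[LHS]trmxK trmx_mul trmxK
      [X in X^T]mx11_scalar tr_scalar_mx -mx11_scalar.
  rewrite -scalemxAl !mxE /= mulr1n => /le_trans; apply.
  rewrite le_eqVlt; apply/orP; left; apply/eqP; ring.
have s0 : 0 <= s.
  by have := Q 1 0; rewrite trmx0 mulmx0 mul0mx mul0mx !mxE; lra.
have [s_eq0|s_neq0] := eqVneq s 0.
  have v0 : v = 0.
    apply/rowP => j; rewrite [RHS]mxE; apply/eqP/negP => /negP vj.
    pose b : 'rV[R]_n := delta_mx 0 j.
    have vb : (v *m b^T) 0 0 = v 0 j.
      rewrite mxE (bigD1 j)//= big1 ?addr0 ?mxE ?eqxx ?mulr1// => i ij.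
      by rewrite !mxE (negbTE ij) mulr0.
    set c := (b *m S1 *m b^T) 0 0.
    (* With [s = 0] the form is affine in [t]; this value of [t] would make it equal to [-1]. *)
    have := Q (- (c + 1) / (2 * v 0 j)) b; rewrite s_eq0 mul0r add0r vb -/c.
    have -> : 2 * (- (c + 1) / (2 * v 0 j)) * v 0 j = - (c + 1) by field.
    lra.
  have [|M1 S1E] := IH S1 symS1.
    by move=> b; have := Q 0 b; rewrite s_eq0; lra.
  exists (block_mx 0 0 0 M1).
  rewrite SE s_eq0 v0 tr_block_mx mulmx_block !trmx0 !mulmx0 !mul0mx !add0r.
  by rewrite -S1E; congr block_mx; apply/matrixP => i j; rewrite !mxE mul0rn.
have sgt0 : 0 < s by rewrite lt_neqAle eq_sym s_neq0.
pose r := Num.sqrt s.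
have r0 : r != 0 by rewrite gt_eqF// sqrtr_gt0.
have rE : r * r = s by rewrite -expr2 sqr_sqrtr.
have [||M1 S1E] := IH (S1 - s^-1 *: (v^T *m v)).
- by rewrite linearB/= linearZ/= trmx_mul trmxK symS1.
- move=> b; set t := (v *m b^T) 0 0.
  (* This is the minimiser in the first coordinate, and the minimum is the value at [b] of the Schur
     complement. *)
  have := Q (- t / s) b; rewrite -/t mulmxBr mulmxBl [X in _ -> 0 <= X]mxE.
  rewrite [X in _ -> 0 <= _ + X]mxE -scalemxAr -scalemxAl [X in _ -> 0 <=
    _ - X]mxE.
  have -> : (b *m (v^T *m v) *m b^T) 0 0 = t ^+ 2.
    rewrite mulmxA -mulmxA.
    have -> : b *m v^T = (v *m b^T)^T by rewrite trmx_mul trmxK.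
    by rewrite [X in X^T]mx11_scalar [X in _ *m X]mx11_scalar -/t tr_scalar_mx
      -scalar_mxM mxE mulr1n expr2.
  move=> /le_trans; apply; rewrite le_eqVlt; apply/orP; left; apply/eqP; field.
  exact: s_neq0.
exists (block_mx r%:M 0 (r^-1 *: v^T) M1).
rewrite SE tr_block_mx mulmx_block !trmx0 !mulmx0 ?mul0mx !addr0.
rewrite tr_scalar_mx -scalar_mxM rE linearZ/= trmxK.
rewrite mul_mx_scalar mul_scalar_mx !scalerA divff// !scale1r.
rewrite -scalemxAl -scalemxAr scalerA -invfM rE -S1E.
by rewrite addrCA subrr addr0.
Qed.

(** * Affine images of the Gaussian law *)

Section density.
Local Open Scope ereal_scope.
Context d (T : measurableType d) (R : realType).
Variables (mu nu : {measure set T -> \bar R}) (p : T -> R).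
Hypothesis mp : measurable_fun setT p.
Hypothesis p0 : forall x, (0 <= p x)%R.
Hypothesis nuE : forall A, measurable A -> nu A = \int[mu]_(x in A) (p x)%:E.
Variable f : T -> \bar R.
Hypothesis mf : measurable_fun setT f.
Hypothesis f0 : forall x, 0 <= f x.
Import HBNNSimple.

Lemma ge0_integral_density : \int[nu]_x f x = \int[mu]_x (f x * (p x)%:E).
Proof.
pose f_ := nnsfun_approx measurableT mf.
have mfp n : measurable_fun setT (fun x => (f_ n x)%:E * (p x)%:E).
  by apply: emeasurable_funM; exact/measurable_EFinP.
transitivity (limn (fun n => \int[nu]_x (f_ n x)%:E)).
  rewrite -monotone_convergence//=.
  - apply: eq_integral => x _; apply/esym/cvg_lim => //=.
    exact: cvg_nnsfun_approx.
  - by move=> n; exact/measurable_EFinP.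
  - by move=> n x _; rewrite lee_fin.
  - by move=> x _ a b ab; rewrite lee_fin//; exact/lefP/nd_nnsfun_approx.
transitivity (limn (fun n => \int[mu]_x ((f_ n x)%:E * (p x)%:E))); last first.
  rewrite -monotone_convergence//=.
  - apply: eq_integral => x _; apply/cvg_lim => //=.
    by apply: cvgeMr => //; exact: cvg_nnsfun_approx.
  - by move=> n x _; rewrite mule_ge0// lee_fin.
  - move=> x _ a b ab; rewrite lee_wpmul2r ?lee_fin//.
    exact/lefP/nd_nnsfun_approx.
congr (limn _); apply/funext => n.
under eq_integral do rewrite fimfunE -fsumEFin//.
rewrite ge0_integral_fsum//; last 2 first.
  - by move=> r; exact/measurable_EFinP/measurable_funM.
  - by move=> r x _; rewrite nnfun_muleindic_ge0.
have mI r : measurable_fun setT (fun x => (r * \1_(f_ n @^-1` [set r]) x)%:E *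
  (p x)%:E).
  by apply: emeasurable_funM; apply/measurable_EFinP => //;
    exact/measurable_funM.
transitivity (\sum_(r \in range (f_ n)) \int[mu]_x
    ((r * \1_(f_ n @^-1` [set r]) x)%:E * (p x)%:E)).
  apply: eq_fsbigr => r _; rewrite integralZl_indic_nnsfun// integral_indic//
    setIT.
  have [r0|r0] := ltP r 0%R.
    rewrite preimage_nnfun0// measure0 mule0 integral0_eq// => x _.
    by rewrite indic0 mulr0 mul0e.
  rewrite nuE// -ge0_integralZl//; last 2 first.
  - exact/measurable_EFinP/measurable_funTS.
  - by move=> x _; rewrite lee_fin.
  rewrite integral_mkcond; apply: eq_integral => x _.
  rewrite patchE indicE; case: ifPn => xA.
    by rewrite mulr1.
  by rewrite mulr0 mul0e.
rewrite -ge0_integral_fsum//.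
  apply: eq_integral => x _; rewrite [in RHS]fimfunE -fsumEFin//
    ge0_mule_fsuml//.
  by move=> r; rewrite nnfun_muleindic_ge0.
by move=> r x _; rewrite mule_ge0 ?lee_fin// -lee_fin nnfun_muleindic_ge0.
Qed.

End density.

(** The pushforward with its measure structure, built from a proof of measurability instead of a
    bundled function. *)
Definition measure_image d1 d2 (T1 : measurableType d1) (T2 : measurableType d2)
    (R : realType) (mu : {measure set T1 -> \bar R}) (f : T1 -> T2)
    (mf : measurable_fun setT f) : {measure set T2 -> \bar R} :=
  measure_function_pushforward__canonical__measure_function_Measure mu mf.

Lemma measurable_affine (R : realType) (a c : R) :
  measurable_fun setT (fun x : R => a * x + c).
Proof. by apply: measurable_funD => //; exact: measurable_funM. Qed.

Section affine.
Context {R : realType}.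
Notation mu := (@lebesgue_measure R).
Variables (a c : R).
Hypothesis a0 : a != 0.
Let aff (x : measurableTypeR R) : measurableTypeR R := a * x + c.
Let maff : measurable_fun setT aff. Proof. exact: measurable_affine. Qed.

(** By uniqueness of Lebesgue measure only the intervals []x, y]] need checking. For [a < 0] the
    preimage is closed at the other end, which does not change its length. *)
Lemma lebesgue_measure_affine (A : set (measurableTypeR R)) : measurable A ->
  mu A = mscale (NngNum (normr_ge0 a)) (measure_image mu maff) A.
Proof.
move=> mA; apply: lebesgue_measure_unique => //= _ [[x y]] _ <-.
rewrite /mscale/= /pushforward lebesgue_measure_itv/=.
have [a_gt0|a_le0] := ltP 0 a.
  have -> : aff @^-1` `]x, y] = [set` `](x - c) / a, (y - c) / a]].
    by apply/seteqP; split => z /=; rewrite !in_itv/=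
      /aff ltr_pdivrMr// ler_pdivlMr// ltrBlDr lerBrDr mulrC.
  rewrite lebesgue_measure_itv/= !lte_fin ltr_pM2r ?invr_gt0// ltrD2r.
  case: ifPn => _; last by rewrite mule0.
  by rewrite -!EFinB -EFinM gtr0_norm//; congr EFin; field.
have a_lt0 : a < 0 by rewrite lt_neqAle a0.
have -> : aff @^-1` `]x, y] = [set` `[(y - c) / a, (x - c) / a[].
  by apply/seteqP; split => z /=; rewrite !in_itv/=
    /aff ltr_ndivlMr// ler_ndivrMr// ltrBlDr lerBrDr mulrC andbC.
rewrite lebesgue_measure_itv/= !lte_fin ltr_nM2r ?invr_lt0// ltrD2r.
case: ifPn => _; last by rewrite mule0.
by rewrite -!EFinB -EFinM ltr0_norm//; congr EFin; field.
Qed.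

Lemma normal_pdf_affine (x : R) :
  normal_pdf c a (a * x + c) * `|a| = normal_pdf 0 1 x.
Proof.
rewrite !normal_pdfE ?oner_eq0// /normal_fun addrK subr0 /normal_peak.
rewrite mulrAC; congr (_ * expR _).
  rewrite expr1n mul1r -[X in Num.sqrt X](mulrnAr) sqrtrM ?sqr_ge0// sqrtr_sqr.
  by rewrite invfM mulrAC mulVf ?mul1r// normr_eq0.
by rewrite expr1n; field.
Qed.

Lemma gauss_affine (A : set R) : measurable A ->
  normal_prob 0 1 ((fun x => a * x + c) @^-1` A) = normal_prob c a A.
Proof.
move=> mA; rewrite /normal_prob.
under eq_integral do rewrite -normal_pdf_affine EFinM.
have mA' : measurable (aff @^-1` A) by rewrite -[X in measurable X]setTI;
  exact: maff.
have mpdf : measurable_fun setT (fun x : measurableTypeR R =>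
  (normal_pdf c a x)%:E).
  by apply/measurable_EFinP; exact: measurable_normal_pdf.
rewrite ge0_integralZr//; last 2 first.
  - by apply: measurable_funTS; exact: (measurableT_comp mpdf maff).
  - by move=> x _; rewrite lee_fin normal_pdf_ge0.
rewrite [RHS](eq_measure_integral
  (mscale (NngNum (normr_ge0 a)) (measure_image mu maff))); last first.
  by move=> B mB _; exact: lebesgue_measure_affine.
rewrite ge0_integral_mscale//; last 2 first.
  - exact: measurable_funTS.
  - by move=> x _; rewrite lee_fin normal_pdf_ge0.
rewrite ge0_integral_pushforward//; first by rewrite muleC.
  exact: measurable_funTS.
by move=> x _; rewrite lee_fin normal_pdf_ge0.
Qed.

End affine.

Lemma gaussian_lawE (R : realType) (m s : R) (A : set R) : measurable A ->
  gaussian_law m s A = normal_prob 0 1 ((fun x => s * x + m) @^-1` A).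
Proof.
move=> mA; rewrite /gaussian_law; have [->|s0] := eqVneq s 0.
  rewrite diracE; have [mA'|mA'] := boolP (m \in A).
    rewrite (_ : _ @^-1` _ = setT) ?probability_setT//.
    by apply/seteqP; split => x //= _; rewrite mul0r add0r; exact: set_mem.
  rewrite (_ : _ @^-1` _ = set0) ?measure0//.
  apply/seteqP; split => x //=; rewrite mul0r add0r => Am.
  by move/negP: mA'; apply; exact: mem_set.
by rewrite gauss_affine.
Qed.

(** * The standard Gaussian law on the line *)

Section gauss1.
Context {R : realType}.
Notation mu := (@lebesgue_measure R).
Notation M := (measurableTypeR R).
Notation gamma := (@normal_prob R 0 1).
Implicit Types (F : M -> \bar R) (a b c s : R).
Local Open Scope ereal_scope.

Let mgaussaff (a c : R) : measurable_fun setT (fun x : M => (a * x + c)%R : M).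
Proof. exact: measurable_affine. Qed.

Let gammaT : gamma [set: M] = 1. Proof. exact: (@probability_setT _ M R gamma).
  Qed.

Let integral_gamma_cst (k : \bar R) : \int[gamma]_x k = k.
Proof. by rewrite integral_cst// [X in _ * X]gammaT mule1. Qed.

Lemma ge0_integral_normal a c F : measurable_fun setT F ->
  (forall x, 0 <= F x) ->
  \int[normal_prob c a]_x F x = \int[mu]_x (F x * (normal_pdf c a x)%:E).
Proof.
move=> mF F0; apply: ge0_integral_density => //.
  exact: measurable_normal_pdf.
by move=> x; exact: normal_pdf_ge0.
Qed.

Lemma ge0_integral_gauss F : measurable_fun setT F -> (forall x, 0 <= F x) ->
  \int[gamma]_x F x = \int[mu]_x (F x * (normal_pdf 0 1 x)%:E).
Proof. exact: ge0_integral_normal. Qed.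

Lemma ge0_integral_gauss_affine a c F : a != 0%R ->
  measurable_fun setT F -> (forall x, 0 <= F x) ->
  \int[gamma]_x F (a * x + c)%R = \int[mu]_x (F x * (normal_pdf c a x)%:E).
Proof.
move=> a0 mF F0; apply: etrans (ge0_integral_normal _ _ mF F0).
transitivity (\int[measure_image gamma (mgaussaff a c)]_x F x).
  by rewrite ge0_integral_pushforward.
apply: eq_measure_integral => A mA _; exact: gauss_affine.
Qed.

Lemma normal01_cameron_martin s F : measurable_fun setT F ->
  (forall x, 0 <= F x) ->
  \int[gamma]_x F (x + s)%R =
  \int[gamma]_x (F x * (expR (s * x - s ^+ 2 / 2))%:E).
Proof.
move=> mF F0; under eq_integral => x _ do rewrite -[x in (x + s)%R]mul1r.
rewrite ge0_integral_gauss_affine ?oner_eq0// ge0_integral_gauss; last 2 first.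
  - apply: emeasurable_funM => //; apply/measurable_EFinP.
    by apply: measurableT_comp => //; apply: measurable_funB => //;
      exact: measurable_funM.
  - by move=> x; rewrite mule_ge0// lee_fin expR_ge0.
apply: eq_integral => x _; rewrite -muleA; congr (_ * _); rewrite -EFinM;
  congr EFin.
rewrite !normal_pdfE ?oner_eq0// /normal_fun mulrCA -expRD.
by congr (_ * expR _)%R; field.
Qed.

(** Bayes' formula for [x = a u + b v]: the joint density of [(x, v)] is written as the law of [v]
    times that of [x] given [v], then as the law of [x] times that of [v] given [x], which is normal
    with mean [b x / s^2] and deviation [a / s]. *)
Lemma normal_pdf_rotation a b s x v : a != 0%R ->
  (s ^+ 2 = a ^+ 2 + b ^+ 2)%R ->
  (normal_pdf (b * v) a x * normal_pdf 0 1 v =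
   normal_pdf 0 s x * normal_pdf (b * x / s ^+ 2) (a / s) v)%R.
Proof.
move=> a0 sE.
have s2 : (0 < a ^+ 2 + b ^+ 2)%R.
  by rewrite ltr_pwDl ?sqr_ge0// exprn_even_gt0.
have s0 : s != 0%R.
  by apply/eqP => s0; move: s2; rewrite -sE s0 expr0n ltxx.
have as0 : (a / s)%R != 0%R by rewrite mulf_neq0// invr_neq0.
rewrite !normal_pdfE ?oner_eq0// /normal_fun /normal_peak.
rewrite mulrACA [RHS]mulrACA -!invfM -!sqrtrM; first last.
- by rewrite mulrn_wge0// mulr_ge0 ?sqr_ge0// pi_ge0.
- by rewrite mulrn_wge0// mulr_ge0 ?sqr_ge0// pi_ge0.
rewrite -!expRD; congr ((Num.sqrt _)^-1 * expR _)%R.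
  by field.
rewrite expr_div_n sE; field.
by rewrite a0 gt_eqF.
Qed.

Lemma normal_pdfN a x : normal_pdf 0 (- a) x = normal_pdf 0 a x.
Proof. by rewrite /normal_pdf oppr_eq0 /normal_fun /normal_peak sqrrN. Qed.

(** After Tonelli and Bayes' formula, the conditional law of [v] integrates to [1]. The case [a = 0]
    is apart, since [a u + b v] then has no density given [v]. *)
Lemma normal01_rotation a b s F : measurable_fun setT F ->
  (forall x, 0 <= F x) ->
  (s ^+ 2 = a ^+ 2 + b ^+ 2)%R ->
  \int[gamma]_v \int[gamma]_u F (a * u + b * v)%R = \int[gamma]_w F (s * w)%R.
Proof.
move=> mF F0 sE.
have [a0|a0] := eqVneq a 0%R.
  transitivity (\int[gamma]_v F (b * v)%R).
    apply: eq_integral => v _.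
    by rewrite a0; under eq_integral do rewrite mul0r add0r;
      rewrite integral_gamma_cst.
  (* Only [s ^+ 2] is prescribed, so [s = - b] remains possible; the centered density does not see
     the sign. *)
  move: sE; rewrite a0 expr0n/= add0r => /eqP; rewrite eqf_sqr =>
    /orP[/eqP->//|/eqP sb].
  have [b0|b0] := eqVneq b 0%R; first by rewrite sb b0 oppr0.
  under eq_integral do rewrite -[(b * _)%R]addr0.
  under [RHS]eq_integral do rewrite -[(s * _)%R]addr0.
  have s0 : s != 0%R by rewrite sb oppr_eq0.
  apply: etrans (ge0_integral_gauss_affine 0 b0 mF F0) _.
  apply: etrans (esym (ge0_integral_gauss_affine 0 s0 mF F0)).
  by apply: eq_integral => x _; rewrite sb normal_pdfN.
have s2 : (0 < a ^+ 2 + b ^+ 2)%R.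
  by rewrite ltr_pwDl ?sqr_ge0// exprn_even_gt0.
have s0 : s != 0%R.
  by apply/eqP => s0; move: s2; rewrite -sE s0 expr0n ltxx.
under [RHS]eq_integral do rewrite -[(s * _)%R]addr0.
rewrite [RHS]ge0_integral_gauss_affine//.
have mpdf m : measurable_fun setT (fun x : M => (normal_pdf m s x)%:E).
  by apply/measurable_EFinP; exact: measurable_normal_pdf.
pose H (z : M * M) := F z.2 * (normal_pdf (b * z.1) a z.2)%:E.
have mH : measurable_fun setT H.
  apply: emeasurable_funM; first exact: (measurableT_comp mF).
  apply/measurable_EFinP.
  rewrite /normal_pdf (negbTE a0) /normal_fun.
  apply: measurable_funM => //; apply: measurableT_comp => //.
  apply: measurable_funM => //; apply: measurableT_comp => //.
  apply: measurable_funX; apply: measurable_funB => //.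
  exact: measurable_funM.
have H0 z : 0 <= H z by rewrite mule_ge0// lee_fin normal_pdf_ge0.
transitivity (\int[gamma]_v \int[mu]_x H (v, x)).
  apply: eq_integral => v _.
  by rewrite ge0_integral_gauss_affine.
rewrite ge0_integral_gauss; last 2 first.
  - exact: measurable_fun_fubini_tonelli_F.
  - by move=> v; apply: integral_ge0.
pose K (z : M * M) := H z * (normal_pdf 0 1 z.1)%:E.
have mK : measurable_fun setT K.
  apply: emeasurable_funM => //; apply/measurable_EFinP.
  by apply: measurableT_comp => //; exact: measurable_normal_pdf.
have K0 z : 0 <= K z by rewrite mule_ge0// lee_fin normal_pdf_ge0.
transitivity (\int[mu]_v \int[mu]_x K (v, x)).
  apply: eq_integral => v _; rewrite /K/= ge0_integralZr//.
  - exact: measurable_fun_pair2.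
  - by rewrite lee_fin normal_pdf_ge0.
rewrite fubini_tonelli//; apply: eq_integral => x _.
transitivity (\int[mu]_v
  (F x * (normal_pdf 0 s x)%:E * (normal_pdf (b * x / s ^+ 2) (a / s) v)%:E)).
  apply: eq_integral => v _; rewrite /K /H/= -!muleA; congr (_ * _).
  by rewrite -!EFinM (normal_pdf_rotation _ _ a0 sE).
rewrite ge0_integralZl//.
- by rewrite integral_normal_pdf mule1.
- by apply/measurable_EFinP; exact: measurable_normal_pdf.
- by move=> v _; rewrite lee_fin normal_pdf_ge0.
- by rewrite mule_ge0// lee_fin normal_pdf_ge0.
Qed.

Let mEF (f : M -> R) : measurable_fun setT f ->
  measurable_fun setT (fun x : M => (f x)%:E).
Proof. by move=> mf; apply/measurable_EFinP. Qed.

Let mexpM (s : R) : measurable_fun setT (fun x : M => (expR (s * x))%:E).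
Proof. by apply: mEF; apply: measurableT_comp => //;
  exact: measurable_funM. Qed.

Let msqr : measurable_fun setT (fun x : M => (x ^+ 2)%:E).
Proof. by apply: mEF; exact: measurable_funX. Qed.

Let mpdf (c a : R) : measurable_fun setT (fun x : M => (normal_pdf c a x)%:E).
Proof. by apply: mEF; exact: measurable_normal_pdf. Qed.

Let mexpsqr (a : R) : measurable_fun setT (fun x : M => (expR (a * x ^+ 2))%:E).
Proof.
apply: mEF; apply: measurableT_comp => //; apply: measurable_funM => //.
Qed.

(** Cameron-Martin applied to the constant [1]: the total mass [1] equals the sought integral times
    [exp (- s^2 / 2)]. *)
Lemma normal01_expR s : \int[gamma]_x (expR (s * x))%:E =
  (expR (s ^+ 2 / 2))%:E.
Proof.
have := @normal01_cameron_martin s (cst 1) (measurable_cst _) (fun=> lee01).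
rewrite [X in X = _ -> _](_ : _ = 1); last exact: integral_gamma_cst.
under [X in _ = X -> _]eq_integral => x _ do
  rewrite mul1e expRD EFinM muleC.
rewrite ge0_integralZl//.
set I := (X in _ = _ * X -> _); move=> h; change (I = (expR (s ^+ 2 / 2))%:E).
have e1 : 1 = (expR (s ^+ 2 / 2))%:E * (expR (- (s ^+ 2 / 2)))%:E.
  by rewrite -EFinM -expRD subrr expR0.
by rewrite -[LHS]mul1e [in LHS]e1 -muleA -h mule1.
Qed.

Lemma normal01_expR_sqr a : (a < 1 / 2)%R ->
  \int[gamma]_x (expR (a * x ^+ 2))%:E < +oo.
Proof.
move=> a2; have a1 : (0 < 1 - 2 * a)%R by lra.
(* The weight [exp (a x^2)] times the standard density is proportional to the centered normal
   density of deviation [s]. *)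
pose s := ((Num.sqrt (1 - 2 * a))^-1)%R.
have s0 : s != 0%R by rewrite invr_neq0// gt_eqF// sqrtr_gt0.
have sE : (s ^+ 2 = (1 - 2 * a)^-1)%R by rewrite exprVn sqr_sqrtr// ltW.
rewrite ge0_integral_gauss//.
rewrite [ltLHS](_ : _ =
  \int[mu]_x ((normal_peak 1 / normal_peak s)%:E * (normal_pdf 0 s x)%:E)).
  rewrite ge0_integralZl//.
  - by rewrite integral_normal_pdf mule1 ltry.
  - by move=> x _; rewrite lee_fin normal_pdf_ge0.
  - by rewrite lee_fin divr_ge0// normal_peak_ge0.
apply: eq_integral => x _; rewrite -!EFinM; congr EFin.
have ps := @normal_peak_gt0 R s s0.
rewrite !normal_pdfE ?oner_eq0// [RHS]mulrA divfK ?gt_eqF// [LHS]mulrCA.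
congr (_ * _)%R; rewrite -expRD /normal_fun sE; congr expR.
by field; rewrite gt_eqF.
Qed.

(** Squaring [y / 2 <= exp (y / 2)] gives the constant [4]. This makes the second moment finite
    through the exponential moments at [1] and [-1]. *)
Lemma sqr_le_expR (x : R) : (x ^+ 2 <= 4 * (expR x + expR (- x)))%R.
Proof.
have h (y : R) : (0 <= y)%R -> (y ^+ 2 <= 4 * expR y)%R.
  move=> y0; have := expR_ge1Dx (y / 2).
  have -> : expR y = (expR (y / 2) ^+ 2)%R by rewrite expr2 -expRD -splitr.
  move: (expR_ge0 (y / 2)); set e := expR _ => e0 he; nra.
have [x0|x0] := leP 0%R x.
  by have := h x x0; have := expR_ge0 (- x); lra.
have := h (- x)%R; rewrite sqrrN => /(_ ltac:(lra)); have := expR_ge0 x; lra.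
Qed.

Let normr_le_1Dsqr (x : R) : (`|x| <= `|1 + x ^+ 2|)%R.
Proof.
rewrite [leRHS]ger0_norm; last by have := sqr_ge0 x; lra.
by rewrite ler_norml; apply/andP; split; nra.
Qed.

Lemma normal01_sqr_lty : \int[gamma]_x (x ^+ 2)%:E < +oo.
Proof.
have me := mexpM.
apply: (@le_lt_trans _ _
  (\int[gamma]_x (4%:E * ((expR (1 * x))%:E + (expR (- 1 * x))%:E)))).
  apply: ge0_le_integral => //.
  - by move=> x _; rewrite lee_fin sqr_ge0.
  - by apply: emeasurable_funM => //; exact: emeasurable_funD.
  - move=> x _; rewrite -EFinD -EFinM lee_fin mul1r mulN1r; exact: sqr_le_expR.
rewrite ge0_integralZl//; last 2 first.
  - exact: emeasurable_funD.
  - by move=> x _; rewrite -EFinD lee_fin addr_ge0// expR_ge0.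
rewrite ge0_integralD//; [|by move=> x _; rewrite lee_fin expR_ge0..].
by rewrite !normal01_expR -EFinD -EFinM ltry.
Qed.

Lemma normal01_sqr_gt0 : 0 < \int[gamma]_x (x ^+ 2)%:E.
Proof.
rewrite lt_neqAle integral_ge0 ?andbT; last by move=> x _;
  rewrite lee_fin sqr_ge0.
apply/eqP => /esym h.
have : \int[gamma]_x `|(x ^+ 2)%:E| = 0.
  by rewrite -h; apply: eq_integral => x _; rewrite gee0_abs// lee_fin sqr_ge0.
move/(ae_eq_integral_abs _ measurableT msqr) => [N [mN N0 hN]].
have : gamma [set~ 0%R] = 0.
  apply/eqP; rewrite -measure_le0 -N0; apply: le_measure; rewrite ?inE//.
    exact: measurableC.
  move=> x /eqP x0; apply: hN => /= /(_ I)[] /eqP; rewrite expf_eq0/=.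
  exact/negP.
have g0 : gamma [set 0%R] = 0.
  rewrite /normal_prob integral_set1//.
move=> gC; have : gamma setT <= 0.
  rewrite -(setUv [set 0%R]) -[leRHS]add0e -[X in X + _]g0 -[X in _ + X]gC.
  by apply: measureU2 => //; exact: measurableC.
by rewrite gammaT; apply/negP; rewrite -ltNge lte01.
Qed.

Lemma normal01_integrable_sqr : gamma.-integrable setT (fun x : M =>
  (x ^+ 2)%:E).
Proof.
apply/integrableP; split; first exact: msqr.
by under eq_integral => x _ do rewrite gee0_abs ?lee_fin ?sqr_ge0//;
  exact: normal01_sqr_lty.
Qed.

Lemma normal01_integrable_id : gamma.-integrable setT (fun x : M => x%:E).
Proof.
apply: (@le_integrable _ _ _ _ _ measurableT _ (fun x : M => (1 + x ^+ 2)%:E)).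
- exact: mEF.
- by move=> x _; exact: normr_le_1Dsqr.
- under eq_fun do rewrite EFinD.
  apply: integrableD => //; last exact: normal01_integrable_sqr.
  apply/integrableP; split => //.
  by under eq_integral do rewrite abse1; rewrite integral_gamma_cst ltry.
Qed.

Lemma normal01_mean0 : \int[gamma]_x x%:E = 0.
Proof.
have mN : measurable_fun setT (fun x : M => (- x)%R : M).
  by apply: measurableT_comp.
have h : \int[gamma]_x x%:E = \int[gamma]_x (- x%:E).
  have <- : \int[measure_image gamma mN]_x x%:E = \int[gamma]_x x%:E.
    apply: eq_measure_integral => A mA _.
    (* Reflection is the affine map of slope [-1], and the centered density depends on the deviation
       only through its square. *)
    transitivity (normal_prob 0 (- 1)%R A).
      rewrite -gauss_affine// ?oppr_eq0 ?oner_eq0//=.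
      suff -> : (fun x : R => -1 * x + 0)%R = -%R by [].
      by apply/funext => x; rewrite mulN1r addr0.
    by apply: eq_integral => x _; rewrite normal_pdfN.
  rewrite integral_pushforward//=.
  exact: (integrableN normal01_integrable_id).
have fin := integrable_fin_num measurableT normal01_integrable_id.
have hN : \int[gamma]_x (- x%:E) = (-1)%:E * \int[gamma]_x x%:E.
  rewrite -integralZl//; last exact: normal01_integrable_id.
  by apply: eq_integral => x _; rewrite EFinN mulN1e.
move: h fin; rewrite {}hN; set I := integral _ _ _.
by case: I => [r| |]//= [h] _; congr EFin; lra.
Qed.

End gauss1.

(* [normal_prob] lives on [measurableTypeR R], whose display differs from the
   default one of [R] used for random variables, hence this transport. *)
Section gauss.
Context {R : realType}.
Notation M := (measurableTypeR R).
Let toR (x : M) : R := x.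
Let mtoR : measurable_fun setT toR.
Proof. by move=> _ A mA; rewrite setTI. Qed.
HB.instance Definition _ := isMeasurableFun.Build _ _ M R toR mtoR.

Definition gauss : probability R R := distribution (normal_prob 0 1) toR.

Local Open Scope ereal_scope.
Implicit Types (F : R -> \bar R) (a b c s : R).

Lemma ge0_integral_gaussE F : measurable_fun setT F -> (forall x, 0 <= F x) ->
  \int[gauss]_x F x = \int[normal_prob 0 1]_x (F : M -> \bar R) x.
Proof. by move=> mF F0; rewrite ge0_integral_pushforward. Qed.

Lemma gaussE (m s : R) (A : set R) : measurable A ->
  gaussian_law m s A = gauss ((fun x => s * x + m)%R @^-1` A).
Proof. exact: gaussian_lawE. Qed.

Lemma gauss_cameron_martin s F : measurable_fun setT F ->
  (forall x, 0 <= F x) ->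
  \int[gauss]_x F (x + s)%R =
  \int[gauss]_x (F x * (expR (s * x - s ^+ 2 / 2))%:E).
Proof.
move=> mF F0.
rewrite ge0_integral_gaussE//; last first.
  by apply: (measurableT_comp mF); exact: measurable_funD.
rewrite [RHS]ge0_integral_gaussE; first exact: normal01_cameron_martin.
  apply: emeasurable_funM => //; apply/measurable_EFinP.
  by apply: measurableT_comp => //; apply: measurable_funB => //;
    exact: measurable_funM.
by move=> x; rewrite mule_ge0// lee_fin expR_ge0.
Qed.

Lemma gauss_rotation a b s F : measurable_fun setT F -> (forall x, 0 <= F x) ->
  (s ^+ 2 = a ^+ 2 + b ^+ 2)%R ->
  \int[gauss]_v \int[gauss]_u F (a * u + b * v)%R = \int[gauss]_w F (s * w)%R.
Proof.
move=> mF F0 sE.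
have mFs c e : measurable_fun setT (fun x => F (c * x + e)%R).
  by apply: (measurableT_comp mF); apply: measurable_funD => //;
    exact: measurable_funM.
rewrite [RHS]ge0_integral_gaussE//; last first.
  by apply: (measurableT_comp mF); exact: measurable_funM.
rewrite -(normal01_rotation mF F0 sE).
pose H (z : R * R) := F (a * z.2 + b * z.1)%R.
have mH : measurable_fun setT H.
  by apply: (measurableT_comp mF); apply: measurable_funD;
    apply: measurable_funM.
have := @measurable_fun_fubini_tonelli_F _ _ _ _ _ gauss H mH (fun=> F0 _) =>
  mG.
rewrite ge0_integral_gaussE; [|exact: mG|by move=> v; exact: integral_ge0].
by apply: eq_integral => v _; rewrite ge0_integral_gaussE.
Qed.

Lemma gauss_expR s : \int[gauss]_x (expR (s * x))%:E = (expR (s ^+ 2 / 2))%:E.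
Proof.
rewrite ge0_integral_gaussE; first exact: normal01_expR.
  apply/measurable_EFinP; apply: measurableT_comp => //; exact: measurable_funM.
by move=> x; rewrite lee_fin expR_ge0.
Qed.

Lemma gauss_expR_sqr a : (a < 1 / 2)%R ->
  \int[gauss]_x (expR (a * x ^+ 2))%:E < +oo.
Proof.
move=> a2; rewrite ge0_integral_gaussE; first exact: normal01_expR_sqr.
  apply/measurable_EFinP; apply: measurableT_comp => //.
  by apply: measurable_funM => //; exact: measurable_funX.
by move=> x; rewrite lee_fin expR_ge0.
Qed.

Let gauss_sqrE : \int[gauss]_x (x ^+ 2)%:E =
  \int[normal_prob 0 1]_(x in [set: M]) (x ^+ 2)%:E.
Proof.
rewrite ge0_integral_gaussE//.
  by apply/measurable_EFinP; exact: measurable_funX.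
by move=> x; rewrite lee_fin sqr_ge0.
Qed.

Lemma gauss_sqr_lty : \int[gauss]_x (x ^+ 2)%:E < +oo.
Proof. by rewrite gauss_sqrE; exact: normal01_sqr_lty. Qed.

Lemma gauss_sqr_gt0 : 0 < \int[gauss]_x (x ^+ 2)%:E.
Proof. by rewrite gauss_sqrE; exact: normal01_sqr_gt0. Qed.

Lemma gauss_integrable_id : gauss.-integrable setT (fun x : R => x%:E).
Proof.
apply: (@integrable_pushforward _ _ _ _ _ _ mtoR) => //.
  exact/measurable_EFinP.
exact: normal01_integrable_id.
Qed.

Lemma gauss_mean0 : \int[gauss]_x x%:E = 0.
Proof.
rewrite integral_pushforward//; first exact: normal01_mean0.
exact: normal01_integrable_id.
Qed.

End gauss.
Arguments gauss R : clear implicits.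

(** * A law on [R^n] is determined by those of linear combinations *)

Lemma bernoulli_ge (R : realType) (h : R) k :
  -1 <= h -> 1 + k%:R * h <= (1 + h) ^+ k.
Proof.
move=> h1; elim: k => [|k IH]; first by rewrite mul0r addr0 expr0.
rewrite exprS -natr1; apply: le_trans (ler_wpM2l _ IH); last by lra.
by have := sqr_ge0 h; have := ler0n R k; nra.
Qed.

(* The exponent makes the limit [0], rather than [1 / e], at [x = 1 / 2]. *)
Lemma cvg_half_threshold (R : realType) (x : R) : 0 <= x <= 1 ->
  (1 - x ^+ k) ^+ (k * 2 ^ k)%N @[k --> \oo] --> ((x < 1 / 2)%R%:R : R).
Proof.
move=> /andP[x0 x1].
have t01 k : 0 <= x ^+ k <= 1 by rewrite exprn_ge0// exprn_ile1.
have u0 k : 0 <= 1 - x ^+ k by have := t01 k; lra.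
have [xlt|xge] := ltP x (1 / 2); last first.
  apply: (@squeeze_cvgr _ _ _ _ (cst 0) (@harmonic R)).
  - near=> k; rewrite exprn_ge0//=.
    set m := (k * 2 ^ k)%N; set t := x ^+ k.
    have mt : k%:R <= m%:R * t.
      rewrite /m natrM natrX -mulrA -exprMn ler_peMr//.
      by apply: exprn_ege1; lra.
    have hB : k%:R + 1 <= (1 + t) ^+ m.
      apply: le_trans (@bernoulli_ge R t m _); first lra.
      by have := t01 k; rewrite -/t; lra.
    rewrite -[leRHS]mul1r ler_pdivlMr ?ltr0n// -natr1.
    (* [(1 - t)^m] is bounded by the inverse of [(1 + t)^m], because [(1 - t^2)^m <= 1]; Bernoulli
       makes that inverse at most [1 / (k + 1)]. *)
    apply: le_trans (_ : (1 - t) ^+ m * (1 + t) ^+ m <= _).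
      by apply: ler_wpM2l => //; apply: exprn_ge0; exact: u0.
    rewrite -exprMn; apply: exprn_ile1; have := t01 k; rewrite -/t => t01'; nra.
  - exact: cvg_cst.
  - exact: cvg_harmonic.
have [->|xn0] := eqVneq x 0.
  apply: cvg_near_cst; near=> k.
  have k0 : (0 < k)%N by near: k; exists 1%N.
  by rewrite expr0n gtn_eqF//= subr0 expr1n.
have xgt0 : 0 < x by rewrite lt_neqAle eq_sym xn0.
(* The square root splits [k (2 x)^k] into [k r^k], bounded by [1 / h] through Bernoulli, and a
   second [r^k], which tends to [0]. *)
pose r := Num.sqrt (2 * x).
have r0 : 0 < r by rewrite sqrtr_gt0; lra.
have r1 : r < 1 by rewrite -[ltRHS]sqrtr1 ltr_sqrt; lra.
have rr : 2 * x = r * r by rewrite -expr2 sqr_sqrtr; lra.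
pose h := r^-1 - 1.
have h0 : 0 < h by rewrite subr_gt0 invf_gt1.
apply: (@squeeze_cvgr _ _ _ _ (fun k => 1 - r ^+ k / h) (cst 1)).
- near=> k; apply/andP; split; last by rewrite exprn_ile1//; have := t01 k; lra.
  set m := (k * 2 ^ k)%N.
  have B : 1 + m%:R * - x ^+ k <= (1 - x ^+ k) ^+ m.
    by apply: bernoulli_ge; have := t01 k; lra.
  apply: le_trans B.
  rewrite mulrN lerD2l lerN2 /m natrM natrX -mulrA -exprMn rr exprMn.
  have hk : k%:R * h <= r^-1 ^+ k.
    have : 1 + k%:R * h <= (1 + h) ^+ k by apply: bernoulli_ge; lra.
    by rewrite [1 + h]addrC subrK; lra.
  have rk : 0 < r ^+ k by exact: exprn_gt0.
  have kh1 : k%:R * h * r ^+ k <= 1 by rewrite -ler_pdivlMr// mul1r -exprVn.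
  rewrite ler_pdivlMr//.
  have -> : k%:R * (r ^+ k * r ^+ k) * h = k%:R * h * r ^+ k * r ^+ k by ring.
  by rewrite ler_piMl// ltW.
- rewrite -[X in _ --> X]subr0; apply: cvgB; first exact: cvg_cst.
  rewrite -[X in _ --> X](mul0r h^-1); apply: cvgM; last exact: cvg_cst.
  by apply: cvg_expr; rewrite ger0_norm ?ltW.
- exact: cvg_cst.
Unshelve. all: by end_near. Qed.

Lemma sin_lt0_sign (R : realType) (t : R) : `|t| < pi -> (sin t < 0) = (t < 0).
Proof.
rewrite ltr_norml => /andP[t1 t2].
have [t0|t0|->] := ltgtP t 0.
- by rewrite -oppr_gt0 -sinN; apply: sin_gt0_pi; lra.
- by apply/negbTE; rewrite -leNgt ltW//; apply: sin_gt0_pi; lra.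
- by rewrite sin0 ltxx.
Qed.

Lemma measurable_lincomb (R : realType) n (a : 'rV[R]_n) :
  measurable_fun setT (@lincomb R n a).
Proof.
apply: measurable_sum => i; apply: measurable_funM => //.
exact: measurable_tnth.
Qed.

Lemma lincombD (R : realType) n (a b : 'rV[R]_n) z :
  lincomb (a + b) z = lincomb a z + lincomb b z.
Proof. by rewrite /lincomb -big_split; apply: eq_bigr => i _;
  rewrite mxE mulrDl. Qed.

Lemma lincombZ (R : realType) n k (a : 'rV[R]_n) z :
  lincomb (k *: a) z = k * lincomb a z.
Proof. by rewrite /lincomb mulr_sumr; apply: eq_bigr => i _;
  rewrite mxE mulrA. Qed.

Lemma lincombN (R : realType) n (a : 'rV[R]_n) z : lincomb (- a) z =
  - lincomb a z.
Proof. by rewrite -scaleN1r lincombZ mulN1r. Qed.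

Lemma lincomb_delta (R : realType) n (i : 'I_n) (z : n.-tuple R) :
  lincomb (delta_mx 0 i) z = tnth z i.
Proof.
rewrite /lincomb (bigD1 i)//= big1 ?addr0 ?mxE ?eqxx ?mul1r// => j ji.
by rewrite mxE (negbTE ji) mul0r.
Qed.

Lemma bounded_integrable d (T : measurableType d) (R : realType)
    (P : probability T R) (f : T -> R) (C : R) : measurable_fun setT f ->
  (forall x, `|f x| <= C) -> P.-integrable setT (EFin \o f).
Proof.
move=> mf fC; apply: measurable_bounded_integrable => //.
  by rewrite [X in (X < _)%E](probability_setT P) ltry.
exists C; split; first exact: num_real.
by move=> M CM x _ /=; apply: le_trans (fC x) _; exact: ltW.
Qed.

Section uniqueness.
Context {R : realType} {n : nat} (mu nu : probability (n.-tuple R) R).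
Local Notation T := (n.-tuple R).

(** The signed measures [f mu] and [f nu] have the same Fourier transform; the free phase [th]
    stands for the real and imaginary parts at once. *)
Definition agree (f : T -> R) : Prop :=
  [/\ measurable_fun setT f, exists C, forall z, `|f z| <= C &
   forall a th, (\int[mu]_z (f z * cos (lincomb a z + th))%:E =
                 \int[nu]_z (f z * cos (lincomb a z + th))%:E)%E].

Let mcos a th : measurable_fun setT (fun z : T => cos (lincomb a z + th)).
Proof.
apply: measurableT_comp; last by apply: measurable_funD => //;
  exact: measurable_lincomb.
by apply: continuous_measurable_fun; exact: continuous_cos.
Qed.

Let fcos_int (P : probability T R) f a th : agree f ->
  P.-integrable setT (EFin \o (fun z => f z * cos (lincomb a z + th))).
Proof.
move=> [mf [C fC] _]; apply: (@bounded_integrable _ _ _ _ _ C).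
  exact: measurable_funM.
by move=> x; rewrite normrM; apply: le_trans (fC x); rewrite ler_piMr ?cos_max.
Qed.

Lemma agree_linear r f g : agree f -> agree g -> agree (fun z => r * f z + g z).
Proof.
move=> Af Ag; have [mf [C fC] Ef] := Af; have [mg [D gD] Eg] := Ag.
split; first by apply: measurable_funD => //; exact: measurable_funM.
  exists (`|r| * C + D) => z; rewrite (le_trans (ler_normD _ _))// lerD//.
  by rewrite normrM ler_wpM2l.
have E (P : probability T R) a th :
   (\int[P]_z ((r * f z + g z) * cos (lincomb a z + th))%:E =
   r%:E * \int[P]_z (f z * cos (lincomb a z + th))%:E +
   \int[P]_z (g z * cos (lincomb a z + th))%:E)%E.
  have If := fcos_int P a th Af; have Ig := fcos_int P a th Ag.
  rewrite -integralZl// -integralD//; last exact: integrableZl.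
  by apply: eq_integral => z _; rewrite /= -EFinM -EFinD; congr EFin; ring.
by move=> a th; rewrite !E Ef Eg.
Qed.

(** A product of cosines is the half sum of the cosines at frequencies [b + a] and [b - a], so the
    tested family is stable under multiplication. *)
Lemma agree_cos f b ph : agree f ->
  agree (fun z => f z * cos (lincomb b z + ph)).
Proof.
move=> Af; have [mf [C fC] Ef] := Af; split; first exact: measurable_funM.
  exists C => x; rewrite normrM; apply: le_trans (fC x).
  by rewrite ler_piMr ?cos_max.
move=> a th.
have E (P : probability T R) :
   (\int[P]_z (f z * cos (lincomb b z + ph) * cos (lincomb a z + th))%:E =
   (1/2)%:E * \int[P]_z (f z * cos (lincomb (b + a) z + (ph + th)))%:E +
   (1/2)%:E * \int[P]_z (f z * cos (lincomb (b - a) z + (ph - th)))%:E)%E.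
  have If := fcos_int P (b + a) (ph + th) Af.
  have Ig := fcos_int P (b - a) (ph - th) Af.
  rewrite -!integralZl// -integralD//; [|exact: integrableZl..].
  apply: eq_integral => z _; rewrite /= -!EFinM -EFinD; congr EFin.
  rewrite !lincombD lincombN.
  have -> : lincomb b z + lincomb a z + (ph + th) =
     (lincomb b z + ph) + (lincomb a z + th) by ring.
  have -> : lincomb b z - lincomb a z + (ph - th) =
     (lincomb b z + ph) - (lincomb a z + th) by ring.
  set u := lincomb b z + ph; set v := lincomb a z + th.
  by rewrite cosB cosD; field.
by rewrite !E !Ef.
Qed.

Lemma agree_lim (f_ : nat -> T -> R) (f : T -> R) C :
  (forall k, agree (f_ k)) ->
  (forall k z, `|f_ k z| <= C) -> (forall z, f_ k z @[k --> \oo] --> f z) ->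
  agree f.
Proof.
move=> Af fC cf.
have mf : measurable_fun setT f.
  by apply: (measurable_fun_cvg (h := f_)) => [k|z _];
    [have [] := Af k|exact: cf].
split=> //.
  exists C => z; have h : `|f_ k z| @[k --> \oo] --> `|f z| by apply: cvg_norm;
    exact: cf.
  rewrite -(cvg_lim _ h)//; apply: limr_le; first by apply/cvg_ex;
    exists `|f z|.
  by near=> k; exact: fC.
have E (P : probability T R) a th :
    (\int[P]_z (f_ k z * cos (lincomb a z + th))%:E @[k --> \oo] -->
     \int[P]_z (f z * cos (lincomb a z + th))%:E)%E.
  have := @dominated_convergence _ _ _ P setT measurableT
    (fun k z => (f_ k z * cos (lincomb a z + th))%:E)
    (fun z => (f z * cos (lincomb a z + th))%:E) (cst C%:E).
  case=> //.
  - by move=> k; apply/measurable_EFinP; apply: measurable_funM => //;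
      have [] := Af k.
  - by apply/measurable_EFinP; exact: measurable_funM.
  - apply: aeW => z _; apply: cvg_EFin; first by near=> k.
    by apply: cvgM => //; exact: cvg_cst.
  - exact: (@bounded_integrable _ _ _ _ (cst C) `|C|).
  - apply: aeW => z k _; rewrite lee_fin normrM; apply: le_trans (fC k z).
    by rewrite ler_piMr ?cos_max.
move=> a th; rewrite -(cvg_lim _ (E mu a th))// -(cvg_lim _ (E nu a th))//.
by congr (limn _); apply/funext => k; have [_ _] := Af k.
Unshelve. all: by end_near. Qed.

(* The sets whose indicator is a multiplier form a sigma-algebra; it contains
   the rays [tnth z i < c], whose indicators are bounded limits of polynomials
   in sines of linear combinations. *)
Definition multiplier (g : T -> R) : Prop := forall f, agree f ->
  agree (fun z => f z * g z).

Lemma eq_multiplier f g : f =1 g -> multiplier f -> multiplier g.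
Proof. by move=> /funext ->. Qed.

Lemma multiplier_cst c : multiplier (cst c).
Proof.
(* [agree_linear] scales only one summand, hence [c] is written as [(c - 1) + 1]. *)
move=> f Af; have := agree_linear (c - 1) Af Af.
by congr agree; apply/funext => z /=; ring.
Qed.

Lemma multiplier_linear r f g : multiplier f -> multiplier g ->
  multiplier (fun z => r * f z + g z).
Proof.
move=> Mf Mg h Ah; have := agree_linear r (Mf _ Ah) (Mg _ Ah).
by congr agree; apply/funext => z /=; ring.
Qed.

Lemma multiplierM f g : multiplier f -> multiplier g ->
  multiplier (fun z => f z * g z).
Proof.
move=> Mf Mg h Ah; have := Mg _ (Mf _ Ah).
by congr agree; apply/funext => z /=; ring.
Qed.

Lemma multiplierX f k : multiplier f -> multiplier (fun z => f z ^+ k).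
Proof.
move=> Mf; elim: k => [|k IH]; first exact: multiplier_cst 1.
by apply: eq_multiplier (multiplierM Mf IH) => z; rewrite exprS.
Qed.

Lemma multiplier1B f : multiplier f -> multiplier (fun z => 1 - f z).
Proof.
move=> Mf; apply: eq_multiplier (multiplier_linear (-1) Mf (multiplier_cst 1)).
by move=> z /=; ring.
Qed.

Lemma multiplier_lim (f_ : nat -> T -> R) (f : T -> R) C :
  (forall k, multiplier (f_ k)) ->
  (forall k z, `|f_ k z| <= C) -> (forall z, f_ k z @[k --> \oo] --> f z) ->
  multiplier f.
Proof.
move=> Mf fC cf h Ah; have [_ [D hD] _] := Ah.
apply: (@agree_lim (fun k z => h z * f_ k z) _ (D * C)).
- by move=> k; exact: Mf.
- by move=> k z; rewrite normrM ler_pM.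
- by move=> z; apply: cvgM => //; exact: cvg_cst.
Qed.

Lemma multiplier_sin b ph : multiplier (fun z => sin (lincomb b z + ph)).
Proof.
move=> f Af; have := agree_cos b (ph - pi / 2) Af.
by congr agree; apply/funext => z; rewrite addrA cosBpihalf.
Qed.

(** Two nested limits. For fixed [k], the condition [s k z < 0] reads [x z < 1/2], whose indicator
    is a limit of polynomials in [x]. As [k] grows, the argument of the sine enters []-pi, pi[],
    where the sine has the sign of [tnth z i - c]. *)
Lemma multiplier_ray i c : multiplier (fun z => (tnth z i < c)%R%:R).
Proof.
pose s (k : nat) (z : T) : R := sin ((tnth z i - c) / k.+1%:R).
apply: (@multiplier_lim (fun k z => (s k z < 0)%R%:R) _ 1).
- move=> k; pose x (z : T) := (1 + s k z) / 2.
  have x01 z : 0 <= x z <= 1.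
    have : `|s k z| <= 1 by exact: sin_max.
    by rewrite ler_norml /x => /andP[? ?]; apply/andP; split; lra.
  apply: (@multiplier_lim (fun k z => (1 - x z ^+ k) ^+ (k * 2 ^ k)%N) _ 1).
  + move=> j; apply: multiplierX; apply: multiplier1B; apply: multiplierX.
    apply: eq_multiplier
      (multiplier_linear (1 / 2) (multiplier_sin (k.+1%:R^-1 *: delta_mx 0 i)
      (- c / k.+1%:R)) (multiplier_cst (1 / 2))) => z /=.
    rewrite lincombZ lincomb_delta /x /s.
    have -> : k.+1%:R^-1 * tnth z i + - c / k.+1%:R =
      (tnth z i - c) / k.+1%:R by ring.
    by field.
  + move=> j z; have /andP[x0 x1] := x01 z.
    have t0 : 0 <= x z ^+ j by exact: exprn_ge0.
    have t1 : x z ^+ j <= 1 by exact: exprn_ile1.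
    by rewrite ger0_norm ?exprn_ge0 ?exprn_ile1//; lra.
  + move=> z; have -> : (s k z < 0) = (x z < 1 / 2).
      by rewrite /x; apply/idP/idP => ?; lra.
    exact: cvg_half_threshold.
- by move=> k z; case: (_ < _); rewrite ?normr1 ?normr0.
- move=> z; apply: cvg_near_cst; near=> k.
  have kpos : 0 < k.+1%:R :> R by rewrite ltr0n.
  rewrite /s sin_lt0_sign.
    by rewrite pmulr_llt0 ?invr_gt0// subr_lt0.
  rewrite normrM normfV [X in _ / X]ger0_norm// ltr_pdivrMr// mulrC
    -ltr_pdivrMr ?pi_gt0//.
  near: k; exists (Num.bound (`|tnth z i - c| / pi)) => // k /= hk.
  apply: (lt_le_trans (archi_boundP _)); first by rewrite divr_ge0// pi_ge0.
  by rewrite ler_nat leqW.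
Unshelve. all: by end_near. Qed.

(** Stability of multipliers under products gives finite intersections, so that a sigma-algebra is
    obtained directly, without a monotone class argument. A countable union is the complement of a
    limit of such intersections. *)
Lemma multiplier_sigma_algebra :
  sigma_algebra setT [set B : set T | multiplier (\1_B)].
Proof.
have hC A : multiplier \1_A -> multiplier \1_(~` A).
  move=> MA; apply: eq_multiplier (multiplier1B MA) => z.
  by rewrite !indicE in_setC; case: (z \in A); rewrite /= ?subrr ?subr0.
split=> [|A|F MF] /=.
- by apply: eq_multiplier (multiplier_cst 0) => z; rewrite indic0.
- by rewrite setTD; exact: hC.
pose G k := \bigcap_(j < k) ~` F j.
have MG k : multiplier \1_(G k).
  elim: k => [|k IH].
    by apply: eq_multiplier (multiplier_cst 1) => z;
      rewrite /G bigcap_mkord big_ord0 indicT.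
  apply: eq_multiplier (multiplierM IH (hC _ (MF k))) => z.
  by rewrite /G !bigcap_mkord big_ord_recr/= indicI.
rewrite -[\bigcup_k F k]setCK setC_bigcup; apply: hC.
apply: (@multiplier_lim (fun k => \1_(G k)) _ 1) => //.
  by move=> k z; rewrite indicE; case: (_ \in _); rewrite ?normr1 ?normr0.
move=> z; apply: cvg_near_cst; rewrite !indicE.
have [zF|] := pselect ((\bigcap_j ~` F j) z).
  rewrite [in X in X%:R]mem_set//; apply: nearW => k.
  by rewrite indicE mem_set// => j _; exact: zF.
move=> /[dup] zF /existsNP[j /not_implyP[_ zFj]].
rewrite [in X in X%:R]memNset//; near=> k.
rewrite indicE memNset// => zG; apply: zFj; apply: zG => /=.
by near: k; exists j.+1.
Unshelve. all: by end_near. Qed.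

Lemma multiplier_measurable (B : set T) : measurable B -> multiplier \1_B.
Proof.
move: B; apply: smallest_sub; first exact: multiplier_sigma_algebra.
rewrite -bigcup_seq => B [i _ [C mC <-]]; rewrite setTI.
pose E := [set C : set R | multiplier \1_((fun z : T => tnth z i) @^-1` C)].
suff h : (R.-ocitv.-measurable).-sigma.-measurable `<=` E by exact: (h C mC).
have [s0 sD sU] := multiplier_sigma_algebra.
rewrite RGenInftyO.measurableE; apply: smallest_sub.
  split=> [|A EA|F EF]; rewrite /E/=.
  - by rewrite preimage_set0; exact: s0.
  - by rewrite setTD preimage_setC -setTD; exact: sD.
  - by rewrite preimage_bigcup; exact: sU.
move=> _ [x ->]; rewrite /E/=; apply: eq_multiplier (multiplier_ray i x) => z.
rewrite indicE; congr (_ %:R); congr nat_of_bool.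
by apply/idP/idP; rewrite inE/= in_itv.
Qed.

Lemma lincomb_law_unique :
  (forall (a : 'rV[R]_n) (A : set R), measurable A ->
    mu (lincomb a @^-1` A) = nu (lincomb a @^-1` A)) ->
  forall B, measurable B -> mu B = nu B.
Proof.
move=> h B mB.
have A1 : agree (cst 1).
  split=> //; first by exists 1 => z; rewrite normr1.
  move=> a th.
  have E (P : probability T R) :
    (\int[P]_z (cst 1 z * cos (lincomb a z + th))%:E =
      \int[measure_image P (measurable_lincomb a)]_x (cos (x + th))%:E)%E.
    rewrite integral_pushforward//.
    - by apply: eq_integral => z _; rewrite mul1r.
    - exact: measurable_lincomb.
    - apply/measurable_EFinP; apply: (@measurableT_comp _ _ _ _ _ _ (@cos R)).
        by apply: continuous_measurable_fun; exact: continuous_cos.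
      exact: measurable_funD.
    - apply: (@bounded_integrable _ _ _ P (fun z => cos (lincomb a z + th)) 1)
        => // z.
      exact: cos_max.
  rewrite !E; apply: eq_measure_integral => A mA _; exact: h.
(* At frequency and phase [0] the cosine is [1], and the equality of integrals becomes
   [mu B = nu B]. *)
have [_ _ /(_ 0 0)] := multiplier_measurable mB A1.
have E (P : probability T R) :
    (\int[P]_z (cst 1 z * \1_B z * cos (lincomb 0 z + 0))%:E = P B)%E.
  transitivity (\int[P]_z (\1_B z)%:E)%E; last by rewrite integral_indic//
    setIT.
  apply: eq_integral => z _.
  rewrite /lincomb big1; last by move=> i _; rewrite mxE mul0r.
  by rewrite addr0 cos0 mul1r mulr1.
by rewrite !E.
Qed.

End uniqueness.

(** * The standard Gaussian law on [R^n] *)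

Section gaussn.
Context {R : realType}.

Definition cons_pair n (p : R * n.-tuple R) : n.+1.-tuple R :=
  [tuple of p.1 :: p.2].

Lemma measurable_cons_pair n : measurable_fun setT (@cons_pair n).
Proof. exact: measurable_cons. Qed.

HB.instance Definition _ n :=
  isMeasurableFun.Build _ _ _ _ (@cons_pair n) (@measurable_cons_pair n).

(** Adding one independent coordinate at a time lets Tonelli reduce integrals over [R^n] to the line
    by induction. *)
Fixpoint gaussn n : probability (n.-tuple R) R :=
  if n is m.+1 then distribution (gauss R \x gaussn m)%E (@cons_pair m)
  else \d_[tuple].

Local Open Scope ereal_scope.

Lemma measurable_tupleP d (T : measurableType d) n (f : T -> n.-tuple R) :
  (forall i, measurable_fun setT (fun t => tnth (f t) i)) ->
    measurable_fun setT f.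
Proof. by move=> mf; apply/measurable_fun_tnthP => i; exact: mf. Qed.

Lemma ge0_integral_gaussnS n (F : n.+1.-tuple R -> \bar R) :
  measurable_fun setT F -> (forall z, 0 <= F z) ->
  \int[gaussn n.+1]_z F z = \int[gauss R]_u \int[gaussn n]_v F
    (cons_pair (u, v)).
Proof.
move=> mF F0; rewrite ge0_integral_pushforward//.
rewrite (fubini_tonelli1 (F \o @cons_pair n))//.
  exact: measurableT_comp.
by move=> x; exact: F0.
Qed.

Lemma ge0_integral_gaussn0 (F : 0.-tuple R -> \bar R) :
  measurable_fun setT F -> \int[gaussn 0]_z F z = F [tuple].
Proof. by move=> mF; rewrite integral_dirac// diracT mul1e. Qed.

Definition sqnorm_tuple n (z : n.-tuple R) : R := (\sum_i tnth z i ^+ 2)%R.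

Definition addv n (z : n.-tuple R) (h : 'rV[R]_n) : n.-tuple R :=
  [tuple (tnth z i + h ord0 i)%R | i < n].

Definition behead_row n (a : 'rV[R]_n.+1) : 'rV[R]_n :=
  (\row_j a ord0 (lift ord0 j))%R.

Lemma sqn_recl n (a : 'rV[R]_n.+1) :
  sqn a = (a ord0 ord0 ^+ 2 + sqn (behead_row a))%R.
Proof. by rewrite /sqn big_ord_recl; congr (_ + _)%R; apply: eq_bigr => i _;
  rewrite mxE. Qed.

Lemma lincomb_cons n (a : 'rV[R]_n.+1) u v :
  lincomb a (cons_pair (u, v)) = (a ord0 ord0 * u + lincomb (behead_row a) v)%R.
Proof.
rewrite /lincomb big_ord_recl; congr (_ * _ + _)%R.
by apply: eq_bigr => i _; rewrite mxE tnthS.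
Qed.

Lemma sqnorm_tuple_cons n u (v : n.-tuple R) : sqnorm_tuple (cons_pair (u, v))
  = (u ^+ 2 + sqnorm_tuple v)%R.
Proof.
rewrite /sqnorm_tuple big_ord_recl; congr (_ ^+ 2 + _)%R.
by apply: eq_bigr => i _; rewrite tnthS.
Qed.

Lemma addv_cons n u (v : n.-tuple R) h :
  addv (cons_pair (u, v)) h =
    cons_pair ((u + h ord0 ord0)%R, addv v (behead_row h)).
Proof.
apply: eq_from_tnth => i; rewrite tnth_mktuple.
case: (unliftP ord0 i) => [j|] ->; last by rewrite !tnth0.
by rewrite !tnthS tnth_mktuple mxE.
Qed.

Lemma measurable_addv n h : measurable_fun setT (fun z : n.-tuple R =>
  addv z h).
Proof.
apply: measurable_tupleP => i; under eq_fun do rewrite tnth_mktuple.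
by apply: measurable_funD => //; exact: measurable_tnth.
Qed.

Lemma measurable_sqnorm_tuple n : measurable_fun setT (@sqnorm_tuple n).
Proof.
apply: measurable_sum => i; apply: measurable_funX; exact: measurable_tnth.
Qed.

(** By induction the tail contributes an independent Gaussian of deviation [t], which
    [gauss_rotation] adds to the first term. Any root [s] of [sqn a] is accepted, including [0]. *)
Lemma gaussn_lincomb n (a : 'rV[R]_n) s (F : R -> \bar R) :
  measurable_fun setT F -> (forall x, 0 <= F x) -> (s ^+ 2 = sqn a)%R ->
  \int[gaussn n]_z F (lincomb a z) = \int[gauss R]_w F (s * w)%R.
Proof.
elim: n a s F => [|n IH] a s F mF F0 sE.
  have -> : s = 0%R by apply/eqP; rewrite -sqrf_eq0 sE /sqn big_ord0.
  rewrite ge0_integral_gaussn0; last by apply: measurableT_comp => //;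
    exact: measurable_lincomb.
  rewrite /lincomb big_ord0; under eq_integral do rewrite mul0r.
  by rewrite integral_cst// [X in _ * X](probability_setT (gauss R)) mule1.
rewrite ge0_integral_gaussnS//; last first.
  by apply: measurableT_comp => //; exact: measurable_lincomb.
pose t := Num.sqrt (sqn (behead_row a)).
have tE : (t ^+ 2 = sqn (behead_row a))%R by rewrite sqr_sqrtr// sqn_ge0.
rewrite -(gauss_rotation (a := t) (b := a ord0 ord0) mF F0); last first.
  by rewrite sE sqn_recl tE addrC.
apply: eq_integral => u _.
under eq_integral do rewrite lincomb_cons addrC.
rewrite (IH _ t (fun x => F (x + a ord0 ord0 * u)%R))//.
by apply: measurableT_comp => //; exact: measurable_funD.
Qed.

Lemma gaussn_expR n (h : 'rV[R]_n) :
  \int[gaussn n]_z (expR (lincomb h z))%:E = (expR (sqn h / 2))%:E.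
Proof.
have sE : (Num.sqrt (sqn h) ^+ 2 = sqn h)%R by rewrite sqr_sqrtr// sqn_ge0.
have mE : measurable_fun setT (fun x : R => (expR x)%:E)
  by apply/measurable_EFinP.
have E0 (x : R) : 0 <= (expR x)%:E by rewrite lee_fin expR_ge0.
by rewrite (gaussn_lincomb mE E0 sE) gauss_expR sE.
Qed.

Lemma gaussn_cameron_martin n (h : 'rV[R]_n) (F : n.-tuple R -> \bar R) :
  measurable_fun setT F -> (forall z, 0 <= F z) ->
  \int[gaussn n]_z F (addv z h) =
  \int[gaussn n]_z (F z * (expR (lincomb h z - sqn h / 2))%:E).
Proof.
have mE m (g : 'rV[R]_m) :
  measurable_fun setT (fun z => (expR (lincomb g z - sqn g / 2))%:E).
  apply/measurable_EFinP; apply: measurableT_comp => //.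
  by apply: measurable_funB => //; exact: measurable_lincomb.
elim: n h F => [|n IH] h F mF F0.
  rewrite !ge0_integral_gaussn0; last first.
  - by apply: measurableT_comp => //; exact: measurable_addv.
  - by apply: emeasurable_funM => //; exact: mE.
  rewrite /lincomb /sqn !big_ord0 mul0r subr0 expR0 mule1; congr F.
  by apply: eq_from_tnth => -[].
rewrite !ge0_integral_gaussnS//; last first.
- by apply: measurableT_comp => //; exact: measurable_addv.
- by move=> z; rewrite mule_ge0// lee_fin expR_ge0.
- by apply: emeasurable_funM => //; exact: mE.
set h0 := h ord0 ord0; set h' := behead_row h.
have mFc (g : R * n.-tuple R -> R * n.-tuple R) : measurable_fun setT g ->
    measurable_fun setT (fun p => F (cons_pair (g p))).
  move=> mg; apply: (measurableT_comp mF).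
  by apply: (measurableT_comp (@measurable_cons_pair n)).
pose K (p : R * n.-tuple R) :=
  F (cons_pair p) * (expR (lincomb h' p.2 - sqn h' / 2))%:E.
have mK : measurable_fun setT K.
  apply: emeasurable_funM; first exact: mFc.
  exact: (measurableT_comp (mE _ h')).
have K0 p : 0 <= K p by rewrite mule_ge0// lee_fin expR_ge0.
transitivity (\int[gauss R]_u \int[gaussn n]_v K ((u + h0)%R, v)).
  apply: eq_integral => u _; under eq_integral do rewrite addv_cons.
  rewrite (IH h' (fun v => F (cons_pair ((u + h0)%R, v))))//.
  exact: (measurable_fun_pair2 (u + h0)%R (mFc _ (@measurable_id _ _ _))).
have mKu : measurable_fun setT (fun u => \int[gaussn n]_v K (u, v)).
  exact: measurable_fun_fubini_tonelli_F.
apply: etrans (gauss_cameron_martin h0 mKu _) _; first by move=> u;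
  exact: integral_ge0.
apply: eq_integral => u _; rewrite -ge0_integralZr//;
  last exact: measurable_fun_pair2.
apply: eq_integral => v _; rewrite /K -muleA -EFinM -expRD lincomb_cons
  sqn_recl.
by congr (_ * (expR _)%:E); rewrite -/h0 -/h'; field.
Qed.

Lemma gaussn_expR_sqr n a : (a < 1 / 2)%R ->
  \int[gaussn n]_z (expR (a * sqnorm_tuple z))%:E < +oo.
Proof.
move=> a2; have mE m : measurable_fun setT (fun z : m.-tuple R =>
  (expR (a * sqnorm_tuple z))%:E).
  apply/measurable_EFinP; apply: measurableT_comp => //.
  by apply: measurable_funM => //; exact: measurable_sqnorm_tuple.
elim: n => [|n IH].
  by rewrite ge0_integral_gaussn0// ltry.
rewrite ge0_integral_gaussnS//.
under eq_integral => u _.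
  under eq_integral do rewrite sqnorm_tuple_cons mulrDr expRD EFinM.
  rewrite ge0_integralZl//; last exact: mE.
  over.
rewrite /= ge0_integralZr//; last 2 first.
- apply/measurable_EFinP; apply: measurableT_comp => //.
  by apply: measurable_funM => //; exact: measurable_funX.
- by apply: integral_ge0 => z _; rewrite lee_fin expR_ge0.
have := gauss_expR_sqr a2.
have : 0 <= \int[gauss R]_x (expR (a * x ^+ 2))%:E.
  by apply: integral_ge0 => z _; rewrite lee_fin expR_ge0.
case: (\int[gauss R]_x _) => [r| |]// r0 _.
exact: lte_mul_pinfty.
Qed.

End gaussn.
Arguments gaussn : clear implicits.

(** * Gaussian smoothing of an event *)

Section probability_integral.
Context d (T : measurableType d) (R : realType) (P : probability T R).
Local Open Scope ereal_scope.

Lemma integral_gt0 (f : T -> R) : measurable_fun setT f ->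
  (forall x, (0 < f x)%R) -> 0 < \int[P]_x (f x)%:E.
Proof.
move=> mf f0; rewrite lt_neqAle integral_ge0 ?andbT; last first.
  by move=> x _; rewrite lee_fin ltW.
apply/eqP => /esym h.
have : \int[P]_x `|(f x)%:E| = 0.
  by rewrite -h; apply: eq_integral => x _; rewrite gee0_abs// lee_fin ltW.
move/(ae_eq_integral_abs _ measurableT (proj2 (measurable_EFinP _ _) mf)).
move=> [N [mN N0 hN]].
have NT : N = setT.
  apply/seteqP; split => // x _; apply: hN => /= /(_ I)[] h0.
  by have := f0 x; rewrite h0 ltxx.
move: N0; rewrite NT [LHS](probability_setT P) => /eqP.
by rewrite onee_eq0.
Qed.

Lemma integral_tail_small (psi : T -> R) (eta : R) : measurable_fun setT psi ->
  (forall x, (0 <= psi x)%R) -> \int[P]_x (psi x)%:E < +oo -> (0 < eta)%R ->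
  exists2 K : R, (0 < K)%R &
    \int[P]_x (psi x * \1_[set x | (K < psi x)%R] x)%:E <= eta%:E.
Proof.
move=> mpsi psi0 ipsi eta0.
pose g (k : nat) x := (psi x * \1_[set x | (k.+1%:R < psi x)%R] x)%R.
have mI k : measurable_fun setT (\1_[set x | (k.+1%:R < psi x)%R] : T -> R).
  apply: measurable_indic.
  rewrite (_ : [set x | _] = psi @^-1` `]k.+1%:R, +oo[); last first.
    by apply/seteqP; split => x /=; rewrite in_itv/= andbT.
  by rewrite -[X in measurable X]setTI; exact: mpsi.
have [] := @dominated_convergence _ _ _ P setT measurableT
  (fun k x => (g k x)%:E) (cst 0) (fun x => (psi x)%:E).
- by move=> k; apply/measurable_EFinP; exact: measurable_funM.
- exact: measurable_cst.
- apply: aeW => x _; apply: cvg_near_cst; near=> k; congr EFin.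
  rewrite /g indicE memNset ?mulr0//=; apply/negP; rewrite -leNgt.
  apply: le_trans (ltW (archi_boundP (psi0 x))) _; rewrite ler_nat leqW//.
  by near: k; exists (Num.bound (psi x)).
- apply/integrableP; split; first exact/measurable_EFinP.
  by under eq_integral do rewrite gee0_abs ?lee_fin//.
- apply: aeW => x k _; rewrite lee_fin /g ger0_norm;
    last by rewrite mulr_ge0// indicE.
  by rewrite ler_piMr// indicE; case: (_ \in _).
move=> _ _; rewrite integral0 => cv.
have : \forall k \near \oo, \int[P]_x (g k x)%:E < eta%:E.
  have nb : nbhs (0 : \bar R) [set y | y < eta%:E].
    by apply: open_ereal_lt'; rewrite lte_fin.
  exact: (cv _ nb).
move=> [k _ /(_ k (leqnn k)) h].
by exists k.+1%:R => //; exact: ltW.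
Unshelve. all: by end_near. Qed.

(* [g ^ 2 <= sqrt (e K) * g] where [psi <= K],
  and [g ^ 2 <= e * psi] elsewhere. *)
Lemma integral_square_small (psi : T -> R) (eta : R) :
  measurable_fun setT psi ->
  (forall x, (0 <= psi x)%R) -> \int[P]_x (psi x)%:E < +oo -> (0 < eta)%R ->
  exists2 e0 : R, (0 < e0)%R & forall (g : T -> R) (e : R),
    measurable_fun setT g ->
    (forall x, (0 <= g x)%R) -> \int[P]_x (g x)%:E = e%:E -> (e <= e0)%R ->
    (forall x, (g x ^+ 2 <= e * psi x)%R) ->
    \int[P]_x (g x ^+ 2)%:E <= (eta * e)%:E.
Proof.
move=> mpsi psi0 ipsi eta0.
have eta2 : (0 < eta / 2)%R by rewrite divr_gt0.
have [K K0 hK] := integral_tail_small mpsi psi0 ipsi eta2.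
(* For [e] below this bound the square root of [e K] is at most [eta / 2]; the other half of [eta]
   pays for the tail of [psi]. *)
exists ((eta / 2) ^+ 2 / K)%R; first by rewrite divr_gt0// exprn_gt0.
move=> g e mg g0 ge ee0 gpsi.
have e0 : (0 <= e)%R by rewrite -lee_fin -ge; apply: integral_ge0 => x _;
  rewrite lee_fin.
have mI : measurable_fun setT (\1_[set x | (K < psi x)%R] : T -> R).
  apply: measurable_indic.
  rewrite (_ : [set x | _] = psi @^-1` `]K, +oo[); last first.
    by apply/seteqP; split => x /=; rewrite in_itv/= andbT.
  by rewrite -[X in measurable X]setTI; exact: mpsi.
have mpI : measurable_fun setT (fun x =>
  (psi x * \1_[set x | (K < psi x)%R] x)%:E).
  by apply/measurable_EFinP; exact: measurable_funM.
have mgE : measurable_fun setT (EFin \o g) by exact/measurable_EFinP.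
have pI0 x : (0 <= psi x * \1_[set x | (K < psi x)%R] x)%R.
  by rewrite mulr_ge0// indicE.
have -> : (eta * e)%:E = (eta / 2)%:E * \int[P]_x (g x)%:E + e%:E *
  (eta / 2)%:E.
  by rewrite ge -!EFinM -EFinD; congr EFin; field.
apply: (@le_trans _ _ (\int[P]_x ((eta / 2)%:E * (g x)%:E +
    e%:E * (psi x * \1_[set x | (K < psi x)%R] x)%:E))); last first.
  rewrite ge0_integralD//; last 4 first.
  - by move=> x _; rewrite -EFinM lee_fin mulr_ge0// ltW.
  - by apply: emeasurable_funM.
  - by move=> x _; rewrite -EFinM lee_fin mulr_ge0.
  - by apply: emeasurable_funM.
  rewrite ge0_integralZl//; last 2 first.
  - by move=> x _; rewrite lee_fin.
  - by rewrite lee_fin ltW.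
  rewrite leeD2l// ge0_integralZl//; last by move=> x _; rewrite lee_fin.
  by rewrite lee_wpmul2l// lee_fin.
apply: ge0_le_integral => //.
- by move=> x _; rewrite lee_fin sqr_ge0.
- by apply/measurable_EFinP; exact: measurable_funX.
- by apply: emeasurable_funD; apply: emeasurable_funM.
move=> x _; rewrite -!EFinM -EFinD lee_fin indicE.
have [xK|xK] := ltP K (psi x).
  rewrite mem_set//= mulr1; apply: le_trans (gpsi x) _.
  by rewrite lerDr mulr_ge0// ltW.
rewrite memNset/=; last by apply/negP; rewrite -leNgt.
rewrite mulr0 mulr0 addr0.
have geta : (g x <= eta / 2)%R.
  rewrite -ler_sqr ?nnegrE ?(ltW eta2)//; apply: le_trans (gpsi x) _.
  apply: le_trans (ler_wpM2l e0 xK) _.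
  by rewrite -ler_pdivlMr.
by rewrite expr2 ler_wpM2r.
Qed.

End probability_integral.

(** * A Harnack inequality for Gaussian smoothing *)

Section smoothing.
Context {R : realType} {n : nat}.
Local Notation T := (n.-tuple R).
Local Open Scope ereal_scope.

Definition axpy (c : R) (u y : T) : T :=
  [tuple (c * tnth u i + tnth y i)%R | i < n].

Definition scalet (c : R) (u : T) : T := [tuple (c * tnth u i)%R | i < n].

Definition sqdist_tuple (x y : T) : R := (\sum_i (tnth x i - tnth y i) ^+ 2)%R.

(** With the preimage of an event under [mxact B1] as [A], this is the function [F] of the overview;
    absorbing [B1] in the set keeps the noise isotropic. *)
Definition smooth (s : R) (A : set T) (y : T) : R :=
  fine (\int[gaussn R n]_u (\1_A (axpy s u y))%:E).

Lemma measurable_axpy c : measurable_fun setT (fun p : T * T => axpy c p.2 p.1).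
Proof.
apply: measurable_tupleP => i; under eq_fun do rewrite tnth_mktuple.
apply: measurable_funD; last exact: (measurableT_comp (measurable_tnth i)).
apply: measurable_funM => //; exact: (measurableT_comp (measurable_tnth i)).
Qed.

Lemma measurable_scalet c : measurable_fun setT (scalet c).
Proof.
apply: measurable_tupleP => i; under eq_fun do rewrite tnth_mktuple.
by apply: measurable_funM => //; exact: measurable_tnth.
Qed.

Section fixed.
Variables (s : R) (A : set T).
Hypothesis mA : measurable A.

Let mI : measurable_fun setT (fun p : T * T => (\1_A (axpy s p.2 p.1) : R)).
Proof. by apply: measurableT_comp;
  [exact: measurable_indic|exact: measurable_axpy]. Qed.

Let mIy y : measurable_fun setT (fun u : T => (\1_A (axpy s u y) : R)).
Proof. exact: (measurable_fun_pair2 y mI). Qed.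

Let int01 y : 0 <= \int[gaussn R n]_u (\1_A (axpy s u y))%:E <= 1.
Proof.
apply/andP; split; first by apply: integral_ge0 => u _; rewrite lee_fin.
apply: (@le_trans _ _ (\int[gaussn R n]_u 1)).
  apply: ge0_le_integral => //.
  - exact/measurable_EFinP.
  - by move=> u _; rewrite lee_fin indicE; case: (_ \in _).
by rewrite integral_cst// mul1e [X in X <= _](probability_setT (gaussn R n)).
Qed.

Lemma smoothE y : (smooth s A y)%:E = \int[gaussn R n]_u (\1_A (axpy s u y))%:E.
Proof.
have /andP[h0 h1] := int01 y.
by rewrite fineK// ge0_fin_numE// (le_lt_trans h1)// ltry.
Qed.

Lemma smooth_ge0 y : (0 <= smooth s A y)%R.
Proof. by rewrite -lee_fin smoothE; have /andP[] := int01 y. Qed.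

Lemma measurable_smooth : measurable_fun setT (smooth s A).
Proof.
have mI' : measurable_fun setT (fun p : T * T => (\1_A (axpy s p.2 p.1))%:E :
  \bar R).
  exact/measurable_EFinP.
apply/measurable_EFinP.
rewrite (_ : EFin \o _ = fun y => \int[gaussn R n]_u (\1_A (axpy s u y))%:E);
  last first.
  by apply/funext => y; rewrite /= smoothE.
apply: (measurable_fun_fubini_tonelli_F (m2 := gaussn R n) _ mI').
by move=> p; rewrite lee_fin.
Qed.

(** Moving from [y] to [x] shifts [u] by [h = (x - y) / s], with Cameron-Martin density [e]. The
    bound is Cauchy-Schwarz for the indicator [Phi = Phi ^ 2] and [e], whose second moment is
    [exp (|h|^2)]. *)
Lemma smooth_harnack x y : s != 0%R ->
  (smooth s A x ^+ 2 <= smooth s A y * expR (sqdist_tuple x y / s ^+ 2))%R.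
Proof.
move=> s0; pose h : 'rV[R]_n := (\row_i ((tnth x i - tnth y i) / s))%R.
have hE : sqn h = (sqdist_tuple x y / s ^+ 2)%R.
  rewrite /sqn /sqdist_tuple mulr_suml; apply: eq_bigr => i _.
  by rewrite mxE expr_div_n.
rewrite -hE; set E := expR (sqn h).
have E0 : (0 < E)%R by exact: expR_gt0.
pose Phi u : R := \1_A (axpy s u y).
pose e u := expR (lincomb h u - sqn h / 2).
have me : measurable_fun setT e.
  by apply: measurableT_comp => //; apply: measurable_funB => //;
    exact: measurable_lincomb.
have xE : (smooth s A x)%:E = \int[gaussn R n]_u ((Phi u)%:E * (e u)%:E).
  rewrite smoothE -(gaussn_cameron_martin h (F := fun u => (Phi u)%:E));
    last 2 first.
  - by apply/measurable_EFinP; exact: mIy.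
  - by move=> u; rewrite lee_fin.
  apply: eq_integral => u _; rewrite /Phi; congr ((\1_A _)%:E).
  apply: eq_from_tnth => i; rewrite !tnth_mktuple mxE; field.
  exact: s0.
have e2 : \int[gaussn R n]_u (e u ^+ 2)%:E = E%:E.
  transitivity (\int[gaussn R n]_u
    ((expR (- sqn h))%:E * (expR (lincomb (2 *: h) u))%:E)).
    apply: eq_integral => u _; rewrite -EFinM -expRD /e expr2 -expRD lincombZ.
    by congr (expR _)%:E; field.
  rewrite ge0_integralZl//; last first.
    by apply/measurable_EFinP; apply: measurableT_comp => //;
      exact: measurable_lincomb.
  by rewrite gaussn_expR -EFinM -expRD sqnZ; congr (expR _)%:E; field.
(* Cauchy-Schwarz in the form of a weighted arithmetic-geometric inequality, integrated pointwise
   with a weight [t] still to be chosen. *)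
have key t : (0 < t)%R ->
    (smooth s A x <= t / 2 * smooth s A y + (2 * t)^-1 * E)%R.
  move=> t0; rewrite -lee_fin EFinD !EFinM xE -e2 smoothE.
  have t20 : 0 <= (t / 2)%:E by rewrite lee_fin divr_ge0// ltW.
  have t21 : 0 <= ((2 * t)^-1)%:E by rewrite lee_fin invr_ge0 mulr_ge0// ltW.
  have mPhi : measurable_fun setT (fun u => (Phi u)%:E).
    by apply/measurable_EFinP; exact: mIy.
  have me2 : measurable_fun setT (fun u => (e u ^+ 2)%:E).
    by apply/measurable_EFinP; exact: measurable_funX.
  have Phi0 u : 0 <= (Phi u)%:E by rewrite lee_fin.
  have e20 u : 0 <= (e u ^+ 2)%:E by rewrite lee_fin sqr_ge0.
  have mtPhi : measurable_fun setT (fun u => (t / 2)%:E * (Phi u)%:E).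
    exact: emeasurable_funM.
  have mte2 : measurable_fun setT (fun u => ((2 * t)^-1)%:E * (e u ^+ 2)%:E).
    exact: emeasurable_funM.
  have tPhi0 u : 0 <= (t / 2)%:E * (Phi u)%:E by exact: mule_ge0.
  have te20 u : 0 <= ((2 * t)^-1)%:E * (e u ^+ 2)%:E by exact: mule_ge0.
  rewrite -(ge0_integralZl _ measurableT mPhi)//
    -(ge0_integralZl _ measurableT me2)//.
  rewrite -(ge0_integralD _ measurableT (fun u _ => tPhi0 u) mtPhi (fun u _ =>
    te20 u) mte2).
  apply: ge0_le_integral => //.
  - by move=> u _; rewrite -EFinM lee_fin mulr_ge0// expR_ge0.
  - by apply: emeasurable_funM => //; apply/measurable_EFinP.
  - exact: emeasurable_funD.
  move=> u _; rewrite -!EFinM -EFinD lee_fin.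
  have Phi2 : (Phi u = Phi u ^+ 2)%R.
    by rewrite /Phi indicE; case: (_ \in _); rewrite /= ?expr1n ?expr0n.
  rewrite [in leRHS]Phi2 -subr_ge0.
  have -> : (t / 2 * Phi u ^+ 2 + (2 * t)^-1 * e u ^+ 2 - Phi u * e u =
      (2 * t)^-1 * (t * Phi u - e u) ^+ 2)%R by field; rewrite gt_eqF.
  by rewrite mulr_ge0 ?sqr_ge0// invr_ge0 mulr_ge0// ltW.
have := smooth_ge0 x; rewrite le_eqVlt => /orP[/eqP <-|x0].
  by rewrite expr0n/= mulr_ge0 ?smooth_ge0// ltW.
(* With this weight the last term is half of [smooth s A x] and moves to the left. It avoids a
   division by [smooth s A y], which may vanish. *)
have := key (E / smooth s A x)%R (divr_gt0 E0 x0).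
have -> : ((2 * (E / smooth s A x))^-1 * E = smooth s A x / 2)%R.
  by field; rewrite !gt_eqF.
move: x0; set a := smooth s A x; set b := smooth s A y => a0 h1.
have h2 : (a / 2 <= E / a / 2 * b)%R by lra.
have := ler_wpM2r (ltW a0) h2.
have -> : (E / a / 2 * b * a = b * E / 2)%R by field; rewrite gt_eqF.
by rewrite expr2; lra.
Qed.

End fixed.
End smoothing.

(** * The second moment of a smoothed event *)

Section smoothing_square.
Context {R : realType} {n : nat}.
Local Notation T := (n.-tuple R).
Local Open Scope ereal_scope.

Lemma measurable_sqdist_tuple (u : T) : measurable_fun setT (sqdist_tuple u).
Proof.
apply: measurable_sum => i; apply: measurable_funX.
by apply: measurable_funB => //; exact: measurable_tnth.
Qed.

(* Completing the square through Cameron-Martin with the shift [2 theta u]. *)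
Lemma gaussn_expR_sqdist (s r : R) (u : T) :
  (0 < s)%R -> (0 < r)%R -> (s ^+ 2 + r ^+ 2 = 1)%R ->
  \int[gaussn R n]_v (expR (- (r ^+ 2 / s ^+ 2 * sqdist_tuple u v)))%:E =
  (expR (- (r ^+ 2 / (1 + r ^+ 2) * sqnorm_tuple u)))%:E *
  \int[gaussn R n]_v (expR (- (r ^+ 2 / s ^+ 2 * sqnorm_tuple v)))%:E.
Proof.
(* By [s^2 + r^2 = 1], [th] equals [k / (1 + 2 k)]. The function [k |u - v|^2 + |v|^2 / 2] of [v]
   has its minimum at [2 th u], with value [th |u|^2]. *)
move=> s0 r0 sr; set k := (r ^+ 2 / s ^+ 2)%R; set th :=
  (r ^+ 2 / (1 + r ^+ 2))%R.
pose h : 'rV[R]_n := (\row_i (2 * th * tnth u i))%R.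
have mG : measurable_fun setT (fun v => (expR (- (k * sqdist_tuple u v)))%:E).
  apply/measurable_EFinP; apply: measurableT_comp => //;
    apply: measurableT_comp => //.
  by apply: measurable_funM => //; exact: measurable_sqdist_tuple.
have mE : measurable_fun setT (fun v : T =>
  (expR (- (lincomb h v - sqn h / 2)))%:E).
  apply/measurable_EFinP; apply: measurableT_comp => //;
    apply: measurableT_comp => //.
  by apply: measurable_funB => //; exact: measurable_lincomb.
have mS : measurable_fun setT (fun v : T => (expR (- (k * sqnorm_tuple v)))%:E).
  apply/measurable_EFinP; apply: measurableT_comp => //;
    apply: measurableT_comp => //.
  by apply: measurable_funM => //; exact: measurable_sqnorm_tuple.
pose F (v : T) : \bar R := (expR (- (k * sqdist_tuple u v)))%:E *
  (expR (- (lincomb h v - sqn h / 2)))%:E.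
have mF : measurable_fun setT F by exact: emeasurable_funM.
have F0 v : 0 <= F v by rewrite mule_ge0// lee_fin expR_ge0.
transitivity (\int[gaussn R n]_v (F v * (expR (lincomb h v - sqn h / 2))%:E)).
  apply: eq_integral => v _; rewrite /F -!EFinM -!expRD; congr (expR _)%:E.
  by rewrite -addrA addNr addr0.
apply: etrans (esym (gaussn_cameron_martin h mF F0)) _.
rewrite -ge0_integralZl//.
apply: eq_integral => v _; rewrite /F -!EFinM -!expRD; congr (expR _)%:E.
rewrite /sqdist_tuple /sqnorm_tuple /lincomb /sqn mulr_suml !mulr_sumr -!sumrB
  -!sumrN -!big_split/=.
apply: eq_bigr => i _; rewrite !tnth_mktuple !mxE /k /th.
have -> : (s ^+ 2 = 1 - r ^+ 2)%R by rewrite -sr addrK.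
have r1 : (1 - r ^+ 2 != 0)%R by rewrite -sr addrK expf_neq0// gt_eqF.
have r2 : (1 + r ^+ 2 != 0)%R by rewrite gt_eqF// ltr_wpDr ?sqr_ge0.
by field; rewrite r1 r2.
Qed.

(** In the Harnack inequality between [r u] and [r v] the exponential is moved to the left before
    integrating in [v]: the right side becomes [e], and the left side the square times
    [C exp (- th |u|^2)]. Hence a [psi] that is independent of [A]. *)
Lemma smooth_sqr_le (s r : R) : (0 < s)%R -> (0 < r)%R ->
  (s ^+ 2 + r ^+ 2 = 1)%R ->
  exists psi : T -> R, [/\ measurable_fun setT psi, forall u, (0 <= psi u)%R,
    \int[gaussn R n]_u (psi u)%:E < +oo &
    forall (A : set T) e u, measurable A ->
      \int[gaussn R n]_v (smooth s A (scalet r v))%:E = e%:E ->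
      (smooth s A (scalet r u) ^+ 2 <= e * psi u)%R].
Proof.
move=> s0 r0 sr; pose k := (r ^+ 2 / s ^+ 2)%R; pose th :=
  (r ^+ 2 / (1 + r ^+ 2))%R.
have k0 : (0 <= k)%R by rewrite divr_ge0 ?sqr_ge0.
have th2 : (th < 1 / 2)%R.
  have r2 : (0 < 1 + r ^+ 2)%R by rewrite ltr_wpDr ?sqr_ge0.
  have s2 : (0 < s ^+ 2)%R by rewrite exprn_gt0.
  rewrite /th ltr_pdivrMr//; lra.
have mk : measurable_fun setT (fun v : T => expR (- (k * sqnorm_tuple v))).
  apply: measurableT_comp => //; apply: measurableT_comp => //.
  by apply: measurable_funM => //; exact: measurable_sqnorm_tuple.
have mth : measurable_fun setT (fun v : T => expR (th * sqnorm_tuple v)).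
  apply: measurableT_comp => //.
  by apply: measurable_funM => //; exact: measurable_sqnorm_tuple.
pose C := \int[gaussn R n]_v (expR (- (k * sqnorm_tuple v)))%:E.
have C0 : 0 < C by apply: integral_gt0 => // v; exact: expR_gt0.
have C1 : C <= 1.
  apply: (@le_trans _ _ (\int[gaussn R n]_u 1)).
    apply: ge0_le_integral => //.
    - by apply/measurable_EFinP.
    - move=> v _; rewrite lee_fin -expR0 ler_expR oppr_le0 mulr_ge0//.
      by apply: sumr_ge0 => i _; exact: sqr_ge0.
  by rewrite integral_cst// mul1e [X in X <= _](probability_setT (gaussn R n)).
have CE : C = (fine C)%:E by rewrite fineK// ge0_fin_numE ?ltW//
  (le_lt_trans C1)// ltry.
have c0 : (0 < fine C)%R by rewrite -lte_fin -CE.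
exists (fun u => expR (th * sqnorm_tuple u) / fine C)%R; split.
- by apply: measurable_funM.
- by move=> u; rewrite divr_ge0 ?expR_ge0// ltW.
- under eq_integral do rewrite EFinM.
  rewrite ge0_integralZr//; last by rewrite lee_fin invr_ge0 ltW.
    have := gaussn_expR_sqr n th2; case: (\int[_]_z _) => [x||]// _.
      by rewrite -EFinM ltry.
    by rewrite gt0_mulNye ?lte_fin ?invr_gt0.
  exact/measurable_EFinP.
move=> A e u mA eE; set a := (smooth s A (scalet r u) ^+ 2)%R.
have a0 : (0 <= a)%R by exact: sqr_ge0.
have md : measurable_fun setT (fun v : T =>
  (expR (- (k * sqdist_tuple u v)))%:E).
  apply/measurable_EFinP; apply: measurableT_comp => //;
    apply: measurableT_comp => //.
  by apply: measurable_funM => //; exact: measurable_sqdist_tuple.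
have : a%:E * ((expR (- (th * sqnorm_tuple u)))%:E * C) <= e%:E.
  rewrite -eE -gaussn_expR_sqdist// -ge0_integralZl//.
  apply: ge0_le_integral => //.
  - by move=> v _; rewrite mule_ge0 ?lee_fin ?expR_ge0.
  - exact: emeasurable_funM.
  - apply/measurable_EFinP; apply: measurableT_comp;
      first exact: measurable_smooth.
    exact: measurable_scalet.
  move=> v _; rewrite -EFinM lee_fin expRN ler_pdivrMr ?expR_gt0//.
  apply: le_trans (smooth_harnack mA (scalet r u) (scalet r v) _) _;
    first by rewrite gt_eqF.
  rewrite le_eqVlt; apply/orP; left; apply/eqP; congr (_ * expR _)%R.
  rewrite /sqdist_tuple mulr_suml mulr_sumr; apply: eq_bigr => i _.
  by rewrite !tnth_mktuple -mulrBr exprMn /k; ring.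
rewrite CE -!EFinM lee_fin expRN; have := expR_gt0 (th * sqnorm_tuple u).
set E := expR _; set c := fine C => E0 h.
have -> : (a = a * (E^-1 * c) * (E / c))%R by field; rewrite !gt_eqF.
by apply: ler_wpM2r => //; rewrite divr_ge0// ltW.
Qed.

Lemma smooth_square_small (s r eta : R) : (0 < s)%R -> (0 < r)%R ->
  (s ^+ 2 + r ^+ 2 = 1)%R -> (0 < eta)%R ->
  exists2 e0 : R, (0 < e0)%R & forall (A : set T) (e : R), measurable A ->
    \int[gaussn R n]_v (smooth s A (scalet r v))%:E = e%:E -> (e <= e0)%R ->
    \int[gaussn R n]_v (smooth s A (scalet r v) ^+ 2)%:E <= (eta * e)%:E.
Proof.
move=> s0 r0 sr eta0; have [psi [mpsi psi0 ipsi hpsi]] :=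
  smooth_sqr_le s0 r0 sr.
have [e0 e00 he] := integral_square_small mpsi psi0 ipsi eta0.
exists e0 => // A e mA eE ee0; apply: (he (fun v => smooth s A (scalet r v)))
  => //.
- apply: measurableT_comp; first exact: measurable_smooth.
  exact: measurable_scalet.
- by move=> v; exact: smooth_ge0.
- by move=> u; exact: hpsi.
Qed.

End smoothing_square.

(** * Centered vectors with a given covariance *)

Section covariance.
Context {R : realType}.
Local Open Scope ereal_scope.

Definition qform n (S : 'M[R]_n) (a : 'rV[R]_n) : R :=
  ((a *m S *m a^T) ord0 ord0)%R.

Lemma qform_sqn n k (M : 'M[R]_(n, k)) a : qform (M *m M^T) a = sqn (a *m M).
Proof. by rewrite /qform -sqnE trmx_mul !mulmxA. Qed.

Lemma qformD n (S S' : 'M[R]_n) a : qform (S + S') a =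
  (qform S a + qform S' a)%R.
Proof. by rewrite /qform mulmxDr mulmxDl mxE. Qed.

(** The law of [Y] is the centered Gaussian one with covariance [S], expressed through linear
    combinations. Accepting every root [s] of the variance covers degenerate directions, with
    [s = 0], and leaves the sign free. *)
Definition has_cov d (T : measurableType d) (P : probability T R) n
    (Y : T -> n.-tuple R) (S : 'M[R]_n) :=
  forall a s (F : R -> \bar R), measurable_fun setT F -> (forall x, 0 <= F x) ->
    (s ^+ 2 = qform S a)%R ->
    \int[P]_t F (lincomb a (Y t)) = \int[gauss R]_w F (s * w)%R.

Definition addt n (y z : n.-tuple R) : n.-tuple R :=
  [tuple (tnth y i + tnth z i)%R | i < n].

Definition mxact n k (M : 'M[R]_(n, k)) (u : k.-tuple R) : n.-tuple R :=
  [tuple lincomb (row i M) u | i < n].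

Lemma lincomb_addt n (a : 'rV[R]_n) y z :
  lincomb a (addt y z) = (lincomb a y + lincomb a z)%R.
Proof.
rewrite /lincomb -big_split; apply: eq_bigr => i _.
by rewrite tnth_mktuple mulrDr.
Qed.

Lemma lincomb_mxact n k (M : 'M[R]_(n, k)) a u :
  lincomb a (mxact M u) = lincomb (a *m M) u.
Proof.
rewrite /lincomb; under eq_bigr do rewrite tnth_mktuple mulr_sumr.
rewrite exchange_big; apply: eq_bigr => j _; rewrite mxE mulr_suml.
by apply: eq_bigr => i _; rewrite mxE mulrA.
Qed.

Lemma measurable_mxact n k (M : 'M[R]_(n, k)) : measurable_fun setT (mxact M).
Proof.
apply: measurable_tupleP => i; under eq_fun do rewrite tnth_mktuple.
exact: measurable_lincomb.
Qed.

Lemma measurable_addt d (T : measurableType d) n (f g : T -> n.-tuple R) :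
  measurable_fun setT f -> measurable_fun setT g ->
  measurable_fun setT (fun t => addt (f t) (g t)).
Proof.
move=> mf mg; apply: measurable_tupleP => i.
under eq_fun do rewrite tnth_mktuple.
apply: measurable_funD.
  exact: (measurableT_comp (measurable_tnth i) mf).
exact: (measurableT_comp (measurable_tnth i) mg).
Qed.

Lemma has_cov_mxact n k (M : 'M[R]_(n, k)) : has_cov (gaussn R k) (mxact M)
  (M *m M^T).
Proof.
move=> a s F mF F0 sE; under eq_integral do rewrite lincomb_mxact.
by rewrite (gaussn_lincomb (s := s))// sE qform_sqn.
Qed.

Lemma gauss_sign (s s' : R) (F : R -> \bar R) : measurable_fun setT F ->
  (forall x, 0 <= F x) -> (s ^+ 2 = s' ^+ 2)%R ->
  \int[gauss R]_w F (s * w)%R = \int[gauss R]_w F (s' * w)%R.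
Proof.
move=> mF F0 ss; rewrite -(gauss_rotation (a := 0%R) (b := s') mF F0);
  last first.
  by rewrite ss expr0n add0r.
apply: eq_integral => v _; under eq_integral do rewrite mul0r add0r.
by rewrite integral_cst// [X in _ * X](probability_setT (gauss R)) mule1.
Qed.

Section sum.
Context d d' (T : measurableType d) (T' : measurableType d').
Variables (P : probability T R) (P' : probability T' R).
Variables (n : nat) (Y : T -> n.-tuple R) (Y' : T' -> n.-tuple R) (S S' :
  'M[R]_n).

Lemma has_cov_add : measurable_fun setT Y -> measurable_fun setT Y' ->
  (forall a, 0 <= qform S a)%R -> (forall a, 0 <= qform S' a)%R ->
  has_cov P Y S -> has_cov P' Y' S' ->
  has_cov (P \x P') (fun p => addt (Y p.1) (Y' p.2)) (S + S').
Proof.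
move=> mY mY' S0 S'0 YS YS' a s F mF F0 sE.
have mla : measurable_fun setT (fun p : T * T' =>
  F (lincomb a (addt (Y p.1) (Y' p.2)))).
  apply: (measurableT_comp mF);
    apply: (measurableT_comp (measurable_lincomb a)).
  by apply: measurable_addt; apply: measurableT_comp.
rewrite (fubini_tonelli1 (fun p : T * T' =>
  F (lincomb a (addt (Y p.1) (Y' p.2)))))//.
pose t := Num.sqrt (qform S a); pose t' := Num.sqrt (qform S' a).
have tE : (t ^+ 2 = qform S a)%R by rewrite sqr_sqrtr.
have tE' : (t' ^+ 2 = qform S' a)%R by rewrite sqr_sqrtr.
have mFx (c : R) : measurable_fun setT (fun y : R => F (c + y)%R).
  by apply: (measurableT_comp mF); exact: measurable_funD.
pose K (p : R * R) := F (p.1 + t' * p.2)%R.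
have mK : measurable_fun setT K.
  by apply: (measurableT_comp mF); apply: measurable_funD => //;
    exact: measurable_funM.
transitivity (\int[P]_y \int[gauss R]_w K (lincomb a (Y y), w)).
  apply: eq_integral => y _; rewrite /fubini_F/=.
  under eq_integral do rewrite lincomb_addt.
  exact: (YS' a t' (fun z => F (lincomb a (Y y) + z)%R)).
rewrite (YS a t (fun x => \int[gauss R]_w K (x, w))) //; last 2 first.
- by apply: measurable_fun_fubini_tonelli_F => // p; exact: F0.
- by move=> x; apply: integral_ge0 => w _; exact: F0.
rewrite -(gauss_rotation (a := t') (b := t) mF F0); last first.
  by rewrite sE qformD tE tE' addrC.
by apply: eq_integral => v _; apply: eq_integral => u _; rewrite /K/= addrC.
Qed.

(** The two vectors live on different spaces: this is what exchanges the given vector for an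
    explicit model with the same covariance. *)
Lemma has_cov_unique : measurable_fun setT Y -> measurable_fun setT Y' ->
  (forall a, 0 <= qform S a)%R -> has_cov P Y S -> has_cov P' Y' S ->
  forall F : n.-tuple R -> \bar R, measurable_fun setT F ->
    (forall z, 0 <= F z) ->
  \int[P]_t F (Y t) = \int[P']_t F (Y' t).
Proof.
move=> mY mY' S0 YS YS' F mF F0.
pose Ym : {mfun T >-> n.-tuple R} :=
  HB.pack Y (isMeasurableFun.Build _ _ _ _ _ mY).
pose Ym' : {mfun T' >-> n.-tuple R} :=
  HB.pack Y' (isMeasurableFun.Build _ _ _ _ _ mY').
have := @lincomb_law_unique R n (distribution P Ym) (distribution P' Ym') =>
  /(_ _) h.
transitivity (\int[distribution P Ym]_z F z);
  first by rewrite ge0_integral_pushforward.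
transitivity (\int[distribution P' Ym']_z F z);
  last by rewrite ge0_integral_pushforward.
apply: eq_measure_integral => B mB _; apply: h => // a A mA.
have mI : measurable_fun setT (fun x : R => (\1_A x)%:E : \bar R).
  by apply/measurable_EFinP; exact: measurable_indic.
have I0 (x : R) : 0 <= (\1_A x : R)%:E by rewrite lee_fin.
have E d0 (T0 : measurableType d0) (P0 : probability T0 R) (Y0 : T0 ->
  n.-tuple R) :
    measurable_fun setT Y0 ->
    P0 (Y0 @^-1` (lincomb a @^-1` A)) = \int[P0]_t (\1_A (lincomb a (Y0 t)))%:E.
  move=> mY0; transitivity
    (\int[P0]_t (\1_(Y0 @^-1` (lincomb a @^-1` A)) t)%:E) => //.
  rewrite integral_indic ?setIT//.
  have := measurableT_comp (measurable_lincomb a) mY0.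
  by move=> /(_ measurableT A mA); rewrite setTI.
change (P (Y @^-1` (lincomb a @^-1` A)) = P' (Y' @^-1` (lincomb a @^-1` A))).
rewrite (E _ _ P Y mY) (E _ _ P' Y' mY').
have tE : (Num.sqrt (qform S a) ^+ 2 = qform S a)%R by rewrite sqr_sqrtr.
by rewrite (YS a _ _ mI I0 tE) (YS' a _ _ mI I0 tE).
Qed.

End sum.
End covariance.

(** * The covariance of a Gaussian vector *)

Section gaussian_vector_covariance.
Context d (T : measurableType d) (R : realType) (P : probability T R).
Local Open Scope ereal_scope.
(** The second moment of [gauss], kept as a symbol: the matrix [S] below is divided by it, so that
    only its finiteness and positivity enter. *)
Let kappa : R := fine (\int[gauss R]_x (x ^+ 2)%:E).

Let kappaE : \int[gauss R]_x (x ^+ 2)%:E = kappa%:E.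
Proof. by rewrite /kappa fineK// ge0_fin_numE ?gauss_sqr_lty// ltW//
  gauss_sqr_gt0. Qed.

Let kappa_gt0 : (0 < kappa)%R.
Proof. by rewrite -lte_fin -kappaE gauss_sqr_gt0. Qed.

Let maff (s m : R) : measurable_fun setT (fun x : R => (s * x + m)%R).
Proof. by apply: measurable_funD => //; exact: measurable_funM. Qed.

Section gaussian_variable.
Variables (Z : T -> R) (m s : R).
Hypothesis mZ : measurable_fun setT Z.
Hypothesis lawZ : forall A, measurable A -> pushforward P Z A =
  gaussian_law m s A.

Let imageE A : measurable A -> A `<=` setT ->
  measure_image P mZ A = measure_image (gauss R) (maff s m) A.
Proof. by move=> mA _; apply: etrans (lawZ mA) _; exact: gaussE. Qed.

Lemma gaussian_ge0_integral (F : R -> \bar R) : measurable_fun setT F ->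
  (forall x, 0 <= F x) ->
  \int[P]_t F (Z t) = \int[gauss R]_w F (s * w + m)%R.
Proof.
move=> mF F0; transitivity (\int[measure_image P mZ]_x F x).
  by rewrite ge0_integral_pushforward.
rewrite (eq_measure_integral _ imageE).
by rewrite ge0_integral_pushforward.
Qed.

Let aff_integrable : (gauss R).-integrable setT (fun w => (s * w + m)%:E).
Proof.
under eq_fun do rewrite EFinD EFinM.
apply: integrableD => //; first by apply: integrableZl => //;
  exact: gauss_integrable_id.
exact: (@bounded_integrable _ _ _ (gauss R) (cst m) `|m|).
Qed.

Lemma gaussian_integrable : P.-integrable setT (EFin \o Z).
Proof.
apply/integrableP; split; first exact/measurable_EFinP.
rewrite (@gaussian_ge0_integral (fun x => `|x%:E|)).
- by have /integrableP[] := aff_integrable.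
- by apply: measurableT_comp => //; exact/measurable_EFinP.
- by move=> x; exact: abse_ge0.
Qed.

Lemma gaussian_mean : \int[P]_t (Z t)%:E = m%:E.
Proof.
transitivity (\int[measure_image P mZ]_x x%:E).
  by rewrite integral_pushforward//; exact: gaussian_integrable.
rewrite (eq_measure_integral _ imageE) integral_pushforward//=;
  try exact: aff_integrable.
transitivity (\int[gauss R]_w (s%:E * w%:E + m%:E)).
  by apply: eq_integral => w _; rewrite /= EFinD EFinM.
rewrite integralD//=; last 2 first.
- by apply: integrableZl => //; exact: gauss_integrable_id.
- exact: (@bounded_integrable _ _ _ (gauss R) (cst m) `|m|).
rewrite integralZl//; last exact: gauss_integrable_id.
by rewrite gauss_mean0 mule0 add0e integral_cst//
  [X in _ * X](probability_setT (gauss R)) mule1.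
Qed.

End gaussian_variable.

Lemma gaussian_second_moment (Z : T -> R) s : measurable_fun setT Z ->
  (forall A, measurable A -> pushforward P Z A = gaussian_law 0 s A) ->
  \int[P]_t (Z t ^+ 2)%:E = (s ^+ 2 * kappa)%:E.
Proof.
move=> mZ lawZ.
rewrite (gaussian_ge0_integral mZ lawZ (F := fun x => (x ^+ 2)%:E));
  last 2 first.
- by apply/measurable_EFinP; exact: measurable_funX.
- by move=> x; rewrite lee_fin sqr_ge0.
under eq_integral do rewrite addr0 exprMn EFinM.
rewrite ge0_integralZl//.
- by rewrite kappaE EFinM.
- by apply/measurable_EFinP; exact: measurable_funX.
- by move=> x _; rewrite lee_fin sqr_ge0.
- by rewrite lee_fin sqr_ge0.
Qed.

Variables (n : nat) (X : T -> n.-tuple R).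
Hypothesis mX : measurable_fun setT X.
Hypothesis gX : gaussian_vector P X.
Hypothesis cX : centered P X.

Let mlX a : measurable_fun setT (fun t => lincomb a (X t)).
Proof. exact: (measurableT_comp (measurable_lincomb a) mX). Qed.

Let mXi i : measurable_fun setT (fun t => tnth (X t) i).
Proof. exact: (measurableT_comp (measurable_tnth i) mX). Qed.

Let Xi_integrable i : P.-integrable setT (EFin \o (fun t => tnth (X t) i)).
Proof.
have [m [s law]] := gX (delta_mx 0%R i).
have := gaussian_integrable (mlX _) law.
by congr (integrable _ _ _); apply/funext => t /=; rewrite lincomb_delta.
Qed.

Let lincomb_mean0 a : \int[P]_t (lincomb a (X t))%:E = 0.
Proof.
under eq_integral do rewrite /lincomb -sumEFin.
rewrite integral_sum//; last first.
  move=> i; rewrite (_ : (fun _ => _) =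
    (fun t => (a 0%R i)%:E * (tnth (X t) i)%:E)).
    by apply: integrableZl => //; exact: Xi_integrable.
  by apply/funext => t; rewrite EFinM.
rewrite big1// => i _; under eq_integral do rewrite EFinM.
rewrite integralZl//; last exact: Xi_integrable.
by have := cX i; rewrite unlock => ->; rewrite mule0.
Qed.

Let law0 a : exists s, forall A, measurable A ->
  pushforward P (fun t => lincomb a (X t)) A = gaussian_law 0 s A.
Proof.
have [m [s law]] := gX a; exists s.
suff -> : 0%R = m by [].
by apply/esym/EFin_inj; rewrite -(gaussian_mean (mlX a) law) lincomb_mean0.
Qed.

Let XX_integrable i j :
  P.-integrable setT (fun t => (tnth (X t) i * tnth (X t) j)%:E).
Proof.
have sq k : P.-integrable setT (fun t => (tnth (X t) k ^+ 2)%:E).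
  apply/integrableP; split; first by apply/measurable_EFinP;
    exact: measurable_funX.
  have [s law] := law0 (delta_mx 0%R k).
  rewrite (eq_integral (fun t => (lincomb (delta_mx 0%R k) (X t) ^+ 2)%:E));
    last first.
    by move=> t _; rewrite lincomb_delta gee0_abs// lee_fin sqr_ge0.
  by rewrite (gaussian_second_moment (mlX _) law) ltry.
apply: (@le_integrable _ _ _ P _ measurableT _
  (fun t => (tnth (X t) i ^+ 2)%:E + (tnth (X t) j ^+ 2)%:E)).
- by apply/measurable_EFinP; exact: measurable_funM.
- move=> t _; rewrite -EFinD /= lee_fin [leRHS]ger0_norm;
    last by rewrite addr_ge0 ?sqr_ge0.
  by rewrite ler_norml; apply/andP; split; nra.
- exact: integrableD.
Qed.

Let S : 'M[R]_n :=
  (\matrix_(i, j) (fine (\int[P]_t (tnth (X t) i * tnth (X t) j)%:E) /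
    kappa))%R.

Let S_sym : S^T = S.
Proof.
apply/matrixP => i j; rewrite !mxE; congr (fine _ / _)%R.
by apply: eq_integral => t _; rewrite mulrC.
Qed.

Let XXE i j : \int[P]_t (tnth (X t) i * tnth (X t) j)%:E = (S i j * kappa)%:E.
Proof.
rewrite mxE divfK ?gt_eqF// fineK//.
exact: integrable_fin_num (XX_integrable i j).
Qed.

(** The second moment of [lincomb a (X t)] is computed from its law and by expanding the square;
    [kappa] cancels. *)
Let S_variance a s : (forall A, measurable A ->
  pushforward P (fun t => lincomb a (X t)) A = gaussian_law 0 s A) ->
  (s ^+ 2 = qform S a)%R.
Proof.
move=> law; have := gaussian_second_moment (mlX a) law.
have aXX i j : P.-integrable setT
    (fun t => (a 0%R i * a 0%R j)%:E * (tnth (X t) i * tnth (X t) j)%:E).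
  by apply: integrableZl => //; exact: XX_integrable.
rewrite (eq_integral (fun t => \sum_i \sum_j
    ((a 0%R i * a 0%R j)%:E * (tnth (X t) i * tnth (X t) j)%:E))); last first.
  move=> t _; rewrite expr2 {1}/lincomb mulr_suml -sumEFin; apply: eq_bigr =>
    i _.
  rewrite /lincomb mulr_sumr -sumEFin; apply: eq_bigr => j _.
  by rewrite -EFinM; congr EFin; ring.
rewrite integral_sum//; last by move=> i; exact: integrable_sum.
under eq_bigr => i _ do rewrite integral_sum//.
under eq_bigr => i _.
  under eq_bigr => j _ do rewrite integralZl// XXE -EFinM.
  rewrite sumEFin; over.
rewrite sumEFin => -[/esym h].
apply: (mulIf (lt0r_neq0 kappa_gt0)); rewrite h /qform mxE mulr_suml.
rewrite exchange_big; apply: eq_bigr => j _; rewrite !mxE !mulr_suml.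
by apply: eq_bigr => i _; ring.
Qed.

Lemma gaussian_vector_cov : exists S : 'M[R]_n,
  [/\ S^T = S, forall a, (0 <= qform S a)%R & has_cov P X S].
Proof.
exists S; split => //.
- by move=> a; have [s law] := law0 a; rewrite -(S_variance law) sqr_ge0.
- move=> a s F mF F0 sE; have [s' law] := law0 a.
  rewrite (gaussian_ge0_integral (mlX a) law mF F0).
  under eq_integral do rewrite addr0.
  by apply: gauss_sign => //; rewrite sE (S_variance law).
Qed.

End gaussian_vector_covariance.

(** * Joint probabilities *)

Lemma measurable_indic_comp d d' (T : measurableType d) (T' : measurableType d')
    (R : realType) (A : set T') (g : T -> T') : measurable A ->
  measurable_fun setT g -> measurable_fun setT (fun t => \1_A (g t) : R).
Proof.
by move=> mA mg; apply: measurableT_comp; [exact: measurable_indic|exact: mg].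
Qed.

Section conditional.
Context {R : realType} {n : nat}.
Local Open Scope ereal_scope.

(** The conditional probability of [A] when the part common to both blocks contributes [x]; along
    [U] it gives the [f] and [g] of the overview. *)
Definition shift_prob (L : 'M[R]_n) (A : set (n.-tuple R)) (x : n.-tuple R) :
  R :=
  fine (\int[gaussn R n]_u (\1_A (addt (mxact L u) x))%:E).

Lemma shift_probE L A x : measurable A ->
  (shift_prob L A x)%:E = \int[gaussn R n]_u (\1_A (addt (mxact L u) x))%:E.
Proof.
move=> mA; rewrite fineK// ge0_fin_numE; last first.
  by apply: integral_ge0 => u _; rewrite lee_fin.
apply: (@le_lt_trans _ _ (\int[gaussn R n]_u 1)); last first.
  by rewrite integral_cst// mul1e [X in X < _](probability_setT (gaussn R n))
    ltry.
apply: ge0_le_integral => //.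
- apply/measurable_EFinP;
    exact: (measurable_indic_comp mA (measurable_addt (measurable_mxact L)
    (measurable_cst x))).
- by move=> u _; rewrite lee_fin indicE; case: (_ \in _).
Qed.

Lemma shift_prob_ge0 L A x : (0 <= shift_prob L A x)%R.
Proof. by apply: fine_ge0; apply: integral_ge0 => u _; rewrite lee_fin. Qed.

Lemma shift_prob_setT L x : shift_prob L setT x = 1%R.
Proof.
apply: EFin_inj; rewrite shift_probE//; under eq_integral do rewrite indicT/=.
by rewrite integral_cst// mul1e [LHS](probability_setT (gaussn R n)).
Qed.

Lemma measurable_shift_prob L A : measurable A ->
  measurable_fun setT (shift_prob L A).
Proof.
move=> mA; apply/measurable_EFinP.
rewrite (_ : EFin \o _ = fun x =>
  \int[gaussn R n]_u (\1_A (addt (mxact L u) x))%:E); last first.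
  by apply/funext => x; rewrite /= shift_probE.
have mI : measurable_fun setT
    (fun p : n.-tuple R * n.-tuple R => (\1_A (addt (mxact L p.2) p.1))%:E :
      \bar R).
  apply/measurable_EFinP;
    exact: (measurable_indic_comp mA
    (measurable_addt (measurableT_comp (measurable_mxact L) measurable_snd)
    measurable_fst)).
apply: (measurable_fun_fubini_tonelli_F (m2 := gaussn R n) _ mI).
by move=> p; rewrite lee_fin.
Qed.

Lemma shift_prob_smooth (B : 'M[R]_n) s r A v :
  shift_prob (s *: B) A (mxact (r *: B) v) =
    smooth s (mxact B @^-1` A) (scalet r v).
Proof.
congr fine; apply: eq_integral => u _; rewrite !indicE.
suff -> : addt (mxact (s *: B) u) (mxact (r *: B) v) =
  mxact B (axpy s u (scalet r v)) by [].
apply: eq_from_tnth => i; rewrite !tnth_mktuple /lincomb -big_split;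
  apply: eq_bigr => j _.
by rewrite /= !mxE !tnth_mktuple; ring.
Qed.

(* [M u] and [r B v] have the same law. *)
Lemma integral_shift_prob N (M : 'M[R]_(n, N)) (B : 'M[R]_n) s r A
    (F : R -> \bar R) :
  (M *m M^T = r ^+ 2 *: (B *m B^T))%R -> measurable A ->
  measurable_fun setT F -> (forall x, 0 <= F x) ->
  \int[gaussn R N]_u F (shift_prob (s *: B) A (mxact M u)) =
  \int[gaussn R n]_v F (smooth s (mxact B @^-1` A) (scalet r v)).
Proof.
move=> MB mA mF F0.
have BE : ((r *: B) *m (r *: B)^T = M *m M^T)%R.
  by rewrite MB linearZ/= -scalemxAl -scalemxAr scalerA expr2.
have hM : has_cov (gaussn R N) (mxact M) (M *m M^T) by exact: has_cov_mxact.
have hB : has_cov (gaussn R n) (mxact (r *: B)) (M *m M^T).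
  by rewrite -BE; exact: has_cov_mxact.
have psd a : (0 <= qform (M *m M^T) a)%R by rewrite qform_sqn sqn_ge0.
have mFf : measurable_fun setT (fun x => F (shift_prob (s *: B) A x)).
  by apply: (measurableT_comp mF); exact: measurable_shift_prob.
apply: etrans (has_cov_unique (measurable_mxact M) (measurable_mxact (r *: B))
  psd hM hB mFf (fun x => F0 _)) _.
by apply: eq_integral => v _; rewrite shift_prob_smooth.
Qed.

End conditional.

(** * The model with common and private noises *)

Section joint.
Context {R : realType} {p q : nat}.
Local Open Scope ereal_scope.

Definition left_tuple (z : (p + q).-tuple R) : p.-tuple R :=
  [tuple tnth z (lshift q i) | i < p].
Definition right_tuple (z : (p + q).-tuple R) : q.-tuple R :=
  [tuple tnth z (rshift p i) | i < q].

Lemma measurable_left_tuple : measurable_fun setT left_tuple.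
Proof.
apply: measurable_tupleP => i; under eq_fun do rewrite tnth_mktuple.
exact: measurable_tnth.
Qed.

Lemma measurable_right_tuple : measurable_fun setT right_tuple.
Proof.
apply: measurable_tupleP => i; under eq_fun do rewrite tnth_mktuple.
exact: measurable_tnth.
Qed.

Lemma lincomb0 n (z : n.-tuple R) : lincomb 0 z = 0%R.
Proof. by rewrite /lincomb big1// => i _; rewrite mxE mul0r. Qed.

Variables (B1 : 'M[R]_p) (B2 : 'M[R]_q) (M : 'M[R]_(p + q)) (s r : R).
Hypotheses (s0 : (0 < s)%R) (r0 : (0 < r)%R) (sr : (s ^+ 2 + r ^+ 2 = 1)%R).
Hypothesis MB1 : (usubmx M *m (usubmx M)^T = r ^+ 2 *: (B1 *m B1^T))%R.
Hypothesis MB2 : (dsubmx M *m (dsubmx M)^T = r ^+ 2 *: (B2 *m B2^T))%R.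

Let L1 : 'M[R]_(p + q, p) := col_mx (s *: B1) 0%R.
Let L2 : 'M[R]_(p + q, q) := col_mx 0%R (s *: B2).
Let S := (M *m M^T + (L1 *m L1^T + L2 *m L2^T))%R.

Let Y (w : (p + q).-tuple R * (p.-tuple R * q.-tuple R)) : (p + q).-tuple R :=
  addt (mxact M w.1) (addt (mxact L1 w.2.1) (mxact L2 w.2.2)).

Let mY : measurable_fun setT Y.
Proof.
apply: measurable_addt; first exact: (measurableT_comp (measurable_mxact M)).
apply: measurable_addt; apply: (measurableT_comp (measurable_mxact _)).
  by apply: measurableT_comp.
by apply: measurableT_comp.
Qed.

Let Y_cov : has_cov (gaussn R (p + q) \x (gaussn R p \x gaussn R q)) Y S.
Proof.
have psd n k (A : 'M[R]_(n, k)) a : (0 <= qform (A *m A^T) a)%R.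
  by rewrite qform_sqn sqn_ge0.
have cov n k (A : 'M[R]_(n, k)) : has_cov (gaussn R k) (mxact A) (A *m A^T).
  exact: has_cov_mxact.
have mLL : measurable_fun setT (fun w => addt (mxact L1 w.1) (mxact L2 w.2)).
  apply: measurable_addt; first exact: (measurableT_comp (measurable_mxact L1)).
  exact: (measurableT_comp (measurable_mxact L2)).
have covLL := has_cov_add (measurable_mxact L1) (measurable_mxact L2)
  (psd _ _ L1)
  (psd _ _ L2) (cov _ _ L1) (cov _ _ L2).
have psdLL a : (0 <= qform (L1 *m L1^T + L2 *m L2^T) a)%R by rewrite qformD
  addr_ge0.
exact: (has_cov_add (measurable_mxact M) mLL (psd _ _ M) psdLL (cov _ _ M)
  covLL).
Qed.

Let left_tupleY w : left_tuple (Y w) =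
  addt (mxact (s *: B1) w.2.1) (mxact (usubmx M) w.1).
Proof.
apply: eq_from_tnth => i; rewrite !tnth_mktuple row_usubmx !rowKu.
by rewrite row0 lincomb0 addr0 addrC.
Qed.

Let right_tupleY w : right_tuple (Y w) =
  addt (mxact (s *: B2) w.2.2) (mxact (dsubmx M) w.1).
Proof.
apply: eq_from_tnth => i; rewrite !tnth_mktuple row_dsubmx !rowKd.
by rewrite row0 lincomb0 add0r addrC.
Qed.

Context d (T : measurableType d) (P : probability T R).
Variable X : T -> (p + q).-tuple R.
Hypothesis mX : measurable_fun setT X.
Hypothesis X_cov : has_cov P X S.

Let joint_law (A : set (p.-tuple R)) (B : set (q.-tuple R)) :
  measurable A -> measurable B ->
  P [set t | A (left_tuple (X t)) /\ B (right_tuple (X t))] =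
  \int[gaussn R (p + q)]_u
    (shift_prob (s *: B1) A (mxact (usubmx M) u) * shift_prob (s *: B2) B
      (mxact (dsubmx M) u))%:E.
Proof.
move=> mA mB; pose D := (left_tuple @^-1` A) `&` (right_tuple @^-1` B).
have mD : measurable D.
  apply: measurableI; rewrite -[X in measurable X]setTI.
    exact: measurable_left_tuple.
  exact: measurable_right_tuple.
have mID : measurable_fun setT (fun z : (p + q).-tuple R => (\1_D z)%:E :
  \bar R).
  by apply/measurable_EFinP; exact: measurable_indic.
have ID0 z : 0 <= (\1_D z : R)%:E by rewrite lee_fin.
have psd a : (0 <= qform S a)%R by rewrite !qformD !qform_sqn !addr_ge0//
  sqn_ge0.
transitivity (\int[P]_t (\1_D (X t))%:E).
  transitivity (\int[P]_t (\1_(X @^-1` D) t)%:E) => //.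
  rewrite integral_indic ?setIT//.
  by rewrite -[X in measurable X]setTI; exact: mX.
rewrite (has_cov_unique mX mY psd X_cov Y_cov mID ID0).
have mIY : measurable_fun setT (fun w => (\1_D (Y w))%:E : \bar R).
  exact: (measurableT_comp mID mY).
rewrite (fubini_tonelli1 (fun w => (\1_D (Y w))%:E))//.
apply: eq_integral => u _; rewrite /fubini_F.
pose fA (u1 : p.-tuple R) : R :=
  \1_A (addt (mxact (s *: B1) u1) (mxact (usubmx M) u)).
pose fB (u2 : q.-tuple R) : R :=
  \1_B (addt (mxact (s *: B2) u2) (mxact (dsubmx M) u)).
have mfA : measurable_fun setT fA.
  exact: (measurable_indic_comp mA (measurable_addt (measurable_mxact _)
    (measurable_cst _))).
have mfB : measurable_fun setT fB.
  exact: (measurable_indic_comp mB (measurable_addt (measurable_mxact _)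
    (measurable_cst _))).
transitivity (\int[gaussn R p \x gaussn R q]_w ((fA w.1)%:E * (fB w.2)%:E)).
  apply: eq_integral => w _; rewrite /fA /fB -EFinM /D indicI/= !indicE;
    congr EFin.
  congr (_%:R * _%:R)%R; congr nat_of_bool.
    by apply/idP/idP; rewrite !inE /preimage/= left_tupleY.
  by apply/idP/idP; rewrite !inE /preimage/= right_tupleY.
rewrite (fubini_tonelli1 (fun w => (fA w.1)%:E * (fB w.2)%:E)); last 2 first.
- by apply: emeasurable_funM; apply/measurable_EFinP; exact: measurableT_comp.
- by move=> w; rewrite mule_ge0// lee_fin.
have fA0 u1 : 0 <= (fA u1)%:E by rewrite lee_fin.
have fB0 u2 : 0 <= (fB u2)%:E by rewrite lee_fin.
have mfAE : measurable_fun setT (fun u1 => (fA u1)%:E)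
  by apply/measurable_EFinP.
have mfBE : measurable_fun setT (fun u2 => (fB u2)%:E)
  by apply/measurable_EFinP.
rewrite EFinM !shift_probE// -(ge0_integralZr _ measurableT mfAE)//; last first.
  by apply: integral_ge0 => u2 _; exact: fB0.
apply: eq_integral => u1 _.
exact: (ge0_integralZl _ measurableT mfBE (fun u2 _ => fB0 u2) (fA0 u1)).
Qed.

Lemma joint_small (eta : R) : (0 < eta)%R ->
  exists2 e0 : R, (0 < e0)%R & forall A B e, measurable A -> measurable B ->
    P [set t | A (left_tuple (X t))] = e%:E ->
      P [set t | B (right_tuple (X t))] = e%:E ->
    (e <= e0)%R ->
    P [set t | A (left_tuple (X t)) /\ B (right_tuple (X t))] <= (eta * e)%:E.
Proof.
move=> eta0.
have [e1 e10 h1] := @smooth_square_small R p s r eta s0 r0 sr eta0.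
have [e2 e20 h2] := @smooth_square_small R q s r eta s0 r0 sr eta0.
exists (Num.min e1 e2); first by rewrite lt_min e10.
move=> A B e mA mB PA PB; rewrite le_min => /andP[ee1 ee2].
have mE : measurable_fun setT (fun x : R => x%:E) by exact/measurable_EFinP.
have mE2 : measurable_fun setT (fun x : R => (x ^+ 2)%:E).
  by apply/measurable_EFinP; exact: measurable_funX.
have E20 (x : R) : 0 <= (x ^+ 2)%:E by rewrite lee_fin sqr_ge0.
pose f u := shift_prob (s *: B1) A (mxact (usubmx M) u).
pose g u := shift_prob (s *: B2) B (mxact (dsubmx M) u).
have mf : measurable_fun setT f.
  by apply: measurableT_comp; [exact: measurable_shift_prob|exact:
    measurable_mxact].
have mg : measurable_fun setT g.
  by apply: measurableT_comp; [exact: measurable_shift_prob|exact: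
    measurable_mxact].
have absE (x : R) : 0 <= `|x|%:E by rewrite lee_fin.
have mAbs : measurable_fun setT (fun x : R => `|x|%:E)
  by apply/measurable_EFinP.
have mA' : measurable (mxact B1 @^-1` A).
  by rewrite -[X in measurable X]setTI; exact: measurable_mxact.
have mB' : measurable (mxact B2 @^-1` B).
  by rewrite -[X in measurable X]setTI; exact: measurable_mxact.
have fE : \int[gaussn R p]_v (smooth s (mxact B1 @^-1` A) (scalet r v))%:E =
  e%:E.
  (* The absolute value stands for the identity because [integral_shift_prob] takes a function
     nonnegative on the whole line. *)
  rewrite -PA; transitivity (\int[gaussn R (p + q)]_u `|f u|%:E).
    rewrite (integral_shift_prob s MB1 mA mAbs absE); apply: eq_integral => v _.
    by rewrite ger0_norm// smooth_ge0.
  (* The marginal law is read off the joint one by taking the full space as the second event. *)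
  transitivity (P [set t | A (left_tuple (X t)) /\ setT (right_tuple (X t))]).
    rewrite joint_law//; apply: eq_integral => u _.
    by rewrite shift_prob_setT mulr1 ger0_norm// shift_prob_ge0.
  by congr (P _); apply/seteqP; split => t //= [].
have gE : \int[gaussn R q]_v (smooth s (mxact B2 @^-1` B) (scalet r v))%:E =
  e%:E.
  rewrite -PB; transitivity (\int[gaussn R (p + q)]_u `|g u|%:E).
    rewrite (integral_shift_prob s MB2 mB mAbs absE); apply: eq_integral => v _.
    by rewrite ger0_norm// smooth_ge0.
  transitivity (P [set t | setT (left_tuple (X t)) /\ B (right_tuple (X t))]).
    rewrite joint_law//; apply: eq_integral => u _.
    by rewrite shift_prob_setT mul1r ger0_norm// shift_prob_ge0.
  by congr (P _); apply/seteqP; split => t //= [].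
have hf : \int[gaussn R (p + q)]_u (f u ^+ 2)%:E <= (eta * e)%:E.
  by rewrite (integral_shift_prob s MB1 mA mE2 E20); exact: h1.
have hg : \int[gaussn R (p + q)]_u (g u ^+ 2)%:E <= (eta * e)%:E.
  by rewrite (integral_shift_prob s MB2 mB mE2 E20); exact: h2.
have mf2 : measurable_fun setT (fun u => (f u ^+ 2)%:E).
  by apply/measurable_EFinP; exact: measurable_funX.
have mg2 : measurable_fun setT (fun u => (g u ^+ 2)%:E).
  by apply/measurable_EFinP; exact: measurable_funX.
rewrite joint_law//.
apply: (@le_trans _ _ (\int[gaussn R (p + q)]_u
    ((1 / 2)%:E * ((f u ^+ 2)%:E + (g u ^+ 2)%:E)))).
  apply: ge0_le_integral => //.
  - by move=> u _; rewrite lee_fin mulr_ge0// shift_prob_ge0.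
  - by apply/measurable_EFinP; exact: measurable_funM.
  - by apply: emeasurable_funM => //; exact: emeasurable_funD.
  move=> u _; rewrite -EFinD -EFinM lee_fin -/(f u) -/(g u).
  by have := sqr_ge0 (f u - g u); nra.
have half0 : 0 <= (1 / 2)%:E :> \bar R by rewrite lee_fin.
rewrite (ge0_integralZl _ measurableT (emeasurable_funD mf2 mg2)
  (fun u _ => adde_ge0 (E20 _) (E20 _)) half0).
rewrite ge0_integralD//.
have -> : (eta * e)%:E = (1 / 2)%:E * ((eta * e)%:E + (eta * e)%:E).
  by rewrite -EFinD -EFinM; congr EFin; field.
by apply: lee_wpmul2l; [rewrite lee_fin|exact: leeD].
Qed.

End joint.

(** * Splitting the covariance *)

Section split.
Context {R : realType} {p q : nat}.

Lemma qform_ul (S : 'M[R]_(p + q)) b : qform S (row_mx b 0) =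
  qform (ulsubmx S) b.
Proof.
rewrite /qform -{1}[S]submxK mul_row_block tr_row_mx mul_row_col.
by rewrite !mul0mx !addr0 trmx0 mulmx0 addr0.
Qed.

Lemma qform_dr (S : 'M[R]_(p + q)) c : qform S (row_mx 0 c) =
  qform (drsubmx S) c.
Proof.
rewrite /qform -{1}[S]submxK mul_row_block tr_row_mx mul_row_col.
by rewrite !mul0mx !add0r trmx0 mulmx0 add0r.
Qed.

(* The null space of [S] is contained in the one of its block diagonal [D], so
   [S - delta D] is still positive semidefinite for a small [delta = s ^ 2]. *)
Lemma psd_split (S : 'M[R]_(p + q)) : S^T = S -> (forall a, 0 <= qform S a) ->
  (forall b c, qform S (row_mx b c) = 0 ->
     qform S (row_mx b 0) = 0 /\ qform S (row_mx 0 c) = 0) ->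
  exists (B1 : 'M[R]_p) (B2 : 'M[R]_q) (M : 'M[R]_(p + q)) (s r : R),
  [/\ 0 < s, 0 < r, s ^+ 2 + r ^+ 2 = 1 &
   [/\ usubmx M *m (usubmx M)^T = r ^+ 2 *: (B1 *m B1^T),
      dsubmx M *m (dsubmx M)^T = r ^+ 2 *: (B2 *m B2^T) &
      S = M *m M^T + (col_mx (s *: B1) 0 *m (col_mx (s *: B1) 0)^T +
                      col_mx 0 (s *: B2) *m (col_mx 0 (s *: B2))^T)]].
Proof.
move=> symS psdS kerS.
have [V SV] := psd_factor symS psdS.
have [||B1 S11] := @psd_factor R p (ulsubmx S).
- by rewrite trmx_ulsub symS.
- by move=> b; have := psdS (row_mx b 0); rewrite qform_ul.
have [||B2 S22] := @psd_factor R q (drsubmx S).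
- by rewrite trmx_drsub symS.
- by move=> b; have := psdS (row_mx 0 b); rewrite qform_dr.
pose L : 'M[R]_(p + q) := block_mx B1 0 0 B2.
have aL b c : row_mx b c *m L = row_mx (b *m B1) (c *m B2).
  by rewrite mul_row_block !mulmx0 addr0 add0r.
have [a|C C0 hC] := @sqn_ker_le R _ _ _ V L.
  rewrite -[a]hsubmxK => aV.
  have [] := kerS (lsubmx a) (rsubmx a).
    by rewrite {1}SV qform_sqn aV /sqn big1// => i _; rewrite mxE expr0n.
  rewrite qform_ul qform_dr S11 S22 !qform_sqn => /sqn_eq0 b0 /sqn_eq0 c0.
  by rewrite aL b0 c0 row_mx0.
(* [de * C <= 1] keeps [S - de L L^T] positive semidefinite, and [de < 1] leaves [r^2 = 1 - de]
   positive. *)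
pose de := (C + 1)^-1.
have C1 : 0 < C + 1 by rewrite ltr_wpDr.
have de0 : 0 < de by rewrite invr_gt0.
have de1 : de < 1 by rewrite invf_lt1// ltrDr.
have deC : de * C <= 1 by rewrite mulrC ler_pdivrMr// mul1r lerDl.
have LL : L *m L^T = block_mx (B1 *m B1^T) 0 0 (B2 *m B2^T).
  by rewrite tr_block_mx !trmx0 mulmx_block !mulmx0 !mul0mx !addr0 !add0r.
pose S' := S - de *: (L *m L^T).
have [||M S'M] := @psd_factor R _ S'.
- by rewrite linearB/= linearZ/= trmx_mul trmxK symS.
- move=> a; have : qform S' a = sqn (a *m V) - de * sqn (a *m L).
    rewrite /S' -scaleNr qformD {1}SV !qform_sqn; congr (_ + _).
    rewrite /qform -scalemxAr -scalemxAl mxE mulNr; congr (- (_ * _)).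
    exact: qform_sqn.
  rewrite -/(qform S' a) => ->; rewrite subr_ge0.
  apply: le_trans (ler_wpM2l (ltW de0) (hC a)) _.
  by rewrite mulrA ler_piMl// sqn_ge0.
exists B1, B2, M, (Num.sqrt de), (Num.sqrt (1 - de)).
have sE : Num.sqrt de ^+ 2 = de by rewrite sqr_sqrtr// ltW.
have rE : Num.sqrt (1 - de) ^+ 2 = 1 - de by rewrite sqr_sqrtr// subr_ge0 ltW.
(* [L L^T] is the block diagonal part of [S]: subtracting [de] times it scales the diagonal blocks
   by [1 - de = r^2] and keeps the cross covariances. *)
have S'E : S' = block_mx ((1 - de) *: (B1 *m B1^T)) (ursubmx S)
                         (dlsubmx S) ((1 - de) *: (B2 *m B2^T)).
  rewrite /S' LL scale_block_mx -{1}[S]submxK opp_block_mx add_block_mx.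
  by rewrite S11 S22 !scaler0 !oppr0 !addr0 !scalerBl !scale1r.
have MM : M *m M^T = block_mx (usubmx M *m (usubmx M)^T)
  (usubmx M *m (dsubmx M)^T)
                              (dsubmx M *m (usubmx M)^T)
                                (dsubmx M *m (dsubmx M)^T).
  by rewrite -{1 2}[M]vsubmxK tr_col_mx mul_col_row.
have [MB1 _ _ MB2] := eq_block_mx (etrans (etrans (esym MM) (esym S'M)) S'E).
split.
- by rewrite sqrtr_gt0.
- by rewrite sqrtr_gt0 subr_gt0.
- by rewrite sE rE addrC subrK.
split; rewrite ?rE//.
have -> : col_mx (Num.sqrt de *: B1) 0 *m (col_mx (Num.sqrt de *: B1) 0)^T +
    col_mx 0 (Num.sqrt de *: B2) *m (col_mx 0 (Num.sqrt de *: B2))^T = de *: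
      (L *m L^T).
  rewrite LL !tr_col_mx !mul_col_row !trmx0 !mulmx0 !mul0mx add_block_mx.
  rewrite !linearZ/= -!scalemxAl !scalerA -!expr2 sE !addr0 !add0r.
  by rewrite scale_block_mx !scaler0.
by rewrite -S'M /S' subrK.
Qed.

End split.

(** * Concatenated vectors *)

Section cat.
Context {R : realType} {p q : nat}.

Lemma left_tuple_cat (u : p.-tuple R) (v : q.-tuple R) :
  left_tuple (cat_tuple u v) = u.
Proof. by apply: eq_from_tnth => i; rewrite tnth_mktuple tnth_lshift. Qed.

Lemma right_tuple_cat (u : p.-tuple R) (v : q.-tuple R) :
  right_tuple (cat_tuple u v) = v.
Proof. by apply: eq_from_tnth => i; rewrite tnth_mktuple tnth_rshift. Qed.

Lemma lincomb_cat a b (u : p.-tuple R) (v : q.-tuple R) :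
  lincomb (row_mx a b) (cat_tuple u v) = lincomb a u + lincomb b v.
Proof.
rewrite /lincomb big_split_ord; congr (_ + _); apply: eq_bigr => i _ /=.
  by rewrite row_mxEl tnth_lshift.
by rewrite row_mxEr tnth_rshift.
Qed.

Lemma measurable_cat_tuple d (T : measurableType d) (f : T -> p.-tuple R)
    (g : T -> q.-tuple R) : measurable_fun setT f -> measurable_fun setT g ->
  measurable_fun setT (fun t => cat_tuple (f t) (g t)).
Proof.
move=> mf mg; apply: measurable_tupleP => i; case: (split_ordP i) => j ->.
  under eq_fun do rewrite tnth_lshift.
  exact: (measurableT_comp (measurable_tnth j) mf).
under eq_fun do rewrite tnth_rshift.
exact: (measurableT_comp (measurable_tnth j) mg).
Qed.

End cat.

(** * Combinations of zero variance and the conclusion *)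

Lemma has_cov_ae0 d (T : measurableType d) (R : realType) (P : probability T R)
  n
    (Y : T -> n.-tuple R) (S : 'M[R]_n) a : measurable_fun setT Y ->
  has_cov P Y S -> qform S a = 0 -> {ae P, forall t, lincomb a (Y t) = 0}.
Proof.
move=> mY YS a0; pose N := [set t | lincomb a (Y t) != 0].
have mN0 : measurable [set x : R | x != 0].
  rewrite (_ : [set x | _] = ~` [set 0]); first exact: measurableC.
  by apply/seteqP; split => x /= /eqP.
have mN : measurable N.
  have := measurableT_comp (measurable_lincomb a) mY.
  by move=> /(_ measurableT _ mN0); rewrite setTI.
exists N; split => //; last by move=> t /= /eqP.
transitivity (\int[P]_t (\1_N t)%:E)%E; first by rewrite integral_indic// setIT.
have mI : measurable_fun setT (fun x : R => (\1_[set x : R | x != 0] x)%:E :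
  \bar R).
  by apply/measurable_EFinP; exact: measurable_indic.
have I0 (x : R) : (0 <= (\1_[set x : R | x != 0] x : R)%:E)%E
  by rewrite lee_fin.
(* Zero variance allows the root [s = 0], and the combination is then compared with the constant
   [0 * w]. *)
have sE : 0 ^+ 2 = qform S a by rewrite a0 expr0n.
transitivity (\int[gauss R]_w (\1_[set x : R | x != 0%R] (0 * w : R))%:E)%E.
  exact: (YS a 0 _ mI I0 sE).
rewrite integral0_eq// => w _; rewrite mul0r indicE memNset//=.
by rewrite eqxx.
Qed.

Lemma increasing_to_filter (R : realType) (u : \bar R) :
  Filter (increasing_to u).
Proof. by case: u => [r| |] /=; exact: filter_filter. Qed.

Theorem corollary3p5 (d : measure_display) (T : measurableType d)
    (R : realType) (P : probability T R) (p q : nat) (hp : (1 <= p)%N)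
    (hq : (1 <= q)%N)
    (X1 : {RV P >-> p.-tuple R}) (X2 : {RV P >-> q.-tuple R})
    (hgauss : gaussian_vector P (fun t => cat_tuple (X1 t) (X2 t)))
    (hcentered : centered P (fun t => cat_tuple (X1 t) (X2 t)))
    (hlin : forall (a : 'rV[R]_p) (b : 'rV[R]_q), a != 0 -> b != 0 ->
      ~ {ae P, forall t, lincomb a (X1 t) = lincomb b (X2 t)})
    (G1 : {mfun p.-tuple R >-> R}) (G2 : {mfun q.-tuple R >-> R})
    (hdist : same_distribution (P := P) (G1 \o X1) (G2 \o X2))
    (hcont : continuous_at_upper_endpoint (P := P) (G1 \o X1)) :
  extremally_independent (P := P) (G1 \o X1) (G2 \o X2).
Proof.
have mX : measurable_fun setT (fun t => cat_tuple (X1 t) (X2 t)).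
  exact: measurable_cat_tuple.
have [S [symS psdS covS]] := gaussian_vector_cov mX hgauss hcentered.
(* If [b] or [c] is zero, one half of the row is the row itself and the other is zero. Otherwise
   zero variance gives [b . X1 = - c . X2] almost surely, with both sides nontrivial, against
   [hlin]. *)
have kerS b c : qform S (row_mx b c) = 0 ->
    qform S (row_mx b 0) = 0 /\ qform S (row_mx 0 c) = 0.
  move=> bc0; have Q0 : qform S 0 = 0 by rewrite /qform !mul0mx mxE.
  have [b0|b0] := eqVneq b 0.
    by rewrite b0 row_mx0; split => //; rewrite -bc0 b0.
  have [c0|c0] := eqVneq c 0.
    by rewrite c0 row_mx0; split => //; rewrite -bc0 c0.
  exfalso; apply: (hlin b (- c) b0); first by rewrite oppr_eq0.
  apply: filterS (has_cov_ae0 mX covS bc0) => t.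
  by rewrite lincomb_cat lincombN => /eqP; rewrite addr_eq0 => /eqP.
have [B1 [B2 [M [s [r [s0 r0 sr [MB1 MB2 SE]]]]]]] := psd_split symS psdS kerS.
rewrite SE in covS.
have small := joint_small s0 r0 sr MB1 MB2 mX covS.
split => //.
  by move=> x; exact: hdist.
set u := upper_endpoint _.
have FF : Filter (increasing_to u) := increasing_to_filter u.
apply/cvgrPdist_le => eta eta0.
have [e0 e00 he] := small eta eta0.
have nb : nbhs (1%E : \bar R) [set y | ((1 - e0)%:E < y)%E].
  by apply: open_ereal_gt'; rewrite lte_fin ltrBlDr ltrDl.
(* Continuity at the upper end point enters here: it brings [e = 1 - F] below the threshold [e0]
   near [u]. *)
have near_u : \forall x \near increasing_to u,
    ((1 - e0)%:E < cdf (P := P) (G1 \o X1) x)%E := hcont _ nb.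
apply: filterS near_u => x hx.
set F := cdf _ x in hx *; set e := 1 - fine F.
have F1 : (F <= 1)%E by exact: cdf_le1.
have Ffin : F \is a fin_num by rewrite ge0_fin_numE ?cdf_ge0//
  (le_lt_trans F1)// ltry.
have eE : e%:E = (1 - F)%E by rewrite /e EFinB fineK.
have e_ge0 : 0 <= e by rewrite /e subr_ge0 -lee_fin fineK.
have ee0 : e <= e0.
  by move: hx; rewrite -(fineK Ffin) lte_fin /e => ?; lra.
have gtE (Y : {RV P >-> R}) : cdf Y x = F -> P [set t | x < Y t] = e%:E.
  move=> YF; rewrite eE -YF -(probability_setC (distribution P Y))//.
  by congr (P _); apply/seteqP; split => t /=; rewrite in_itv/= ltNge => /negP.
have mray : measurable `]x, +oo[ by [].
have mA : measurable (G1 @^-1` `]x, +oo[).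
  have mG1 : measurable_fun setT G1 by exact: measurable_funPT.
  by have := mG1 measurableT _ mray; rewrite setTI.
have mB : measurable (G2 @^-1` `]x, +oo[).
  have mG2 : measurable_fun setT G2 by exact: measurable_funPT.
  by have := mG2 measurableT _ mray; rewrite setTI.
have PA : P [set t | (G1 @^-1` `]x,
  +oo[) (left_tuple (cat_tuple (X1 t) (X2 t)))] = e%:E.
  rewrite -(gtE (G1 \o X1) erefl); congr (P _).
  by apply/seteqP; split => t /=; rewrite left_tuple_cat in_itv/= andbT.
have PB : P [set t | (G2 @^-1` `]x,
  +oo[) (right_tuple (cat_tuple (X1 t) (X2 t)))] = e%:E.
  rewrite -(gtE (G2 \o X2)); last by apply/esym; exact: hdist.
  congr (P _).
  by apply/seteqP; split => t /=; rewrite right_tuple_cat in_itv/= andbT.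
have := he _ _ e mA mB PA PB ee0.
have -> : [set t | (G1 @^-1` `]x, +oo[) (left_tuple (cat_tuple (X1 t) (X2 t)))
  /\
    (G2 @^-1` `]x, +oo[) (right_tuple (cat_tuple (X1 t) (X2 t)))] =
    [set t | x < (G1 \o X1) t /\ x < (G2 \o X2) t].
  by apply/seteqP; split => t /=; rewrite left_tuple_cat right_tuple_cat
    !in_itv/= !andbT.
set pj := P _; move=> hpj.
have pj0 : (0 <= pj)%E by exact: measure_ge0.
have pjfin : pj \is a fin_num by rewrite ge0_fin_numE// (le_lt_trans hpj)//
  ltry.
rewrite sub0r normrN ger0_norm; last by rewrite divr_ge0// fine_ge0.
(* For [e = 0] the quotient is [0] by the convention [0^-1 = 0]. *)
have [->|en0] := eqVneq e 0; first by rewrite invr0 mulr0 ltW.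
have egt0 : 0 < e by rewrite lt_neqAle eq_sym en0.
by rewrite ler_pdivrMr// -lee_fin fineK.
Qed.
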